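(* Assume $F_\omega=F_{(\omega_i)_{i\le0}}$, i.e. $F_\omega=F_{\omega'}$ whenever $\omega_i=\omega_i'$ for all $i\le0$. Let $\widehat\eta$ be an $\widehat F$-invariant Borel probability measure on $\Sigma\times X$. Then $$\widehat P_{\widehat\eta}(\widehat\phi)\le P_{\widehat\eta}(\widehat\phi):=h_{\widehat\eta}(\widehat F)+\int\widehat\phi\,d\widehat\eta,$$ and equality holds if and only if $\widehat\eta$ is future independent and the fiber entropy of $\widehat\eta$ is zero.
   Context: Setting: $\Sigma$ is a two-sided compact (finite alphabet), topologically transitive topological Markov shift with left shift $T:\Sigma\to\Sigma$; $X$ is a compact metric space; $\omega\mapsto F_\omega$ is a Hölder continuous map from $\Sigma$ into the space $C_\alpha(X,X)$ of $\alpha$-Hölder maps of $X$, where each $F_\omega$ is an $\alpha$-Hölder homeomorphism of $X$. The skew product is $\widehat F(\omega,t)=(T\omega,F_\omega(t))$ on $\Sigma\times X$, $\pi:\Sigma\times X\to\Sigma$ is the projection, and $\widehat\phi:\Sigma\times X\to\mathbb R$ is Hölder continuous. $h_{\widehat\eta}(\widehat F)$ is the usual metric entropy; the fiber entropy of $\widehat\eta$ is the relative metric entropy of $\widehat F$ over the factor $(\Sigma,T,\eta)$, $\eta=\widehat\eta\circ\pi^{-1}$, i.e. $h_{\widehat\eta}(\widehat F)-h_\eta(T)$. Let $\Sigma^-=\{(\omega_i)_{i\le-1}:\omega\in\Sigma\}$ and, for $\omega^-\in\Sigma^-$, $V^u_{\le-1}(\omega^-)=\{\omega\in\Sigma:\omega_i=\omega^-_i\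 \forall i\le-1\}$. Let $\widehat{\mathcal C}=\{[a]\times X\}_a$ ($a$ ranging over symbols, $[a]=\{\omega:\omega_0=a\}$) and $\widehat{\mathcal C}_n=\bigvee_{i=0}^{n-1}\widehat F^{-i}\widehat{\mathcal C}$. Metric entropy and metric pressure out of equilibrium: let $\widehat\eta=\int\eta_{(\omega^-,t)}\,d\tau(\omega^-,t)$ be the disintegration of $\widehat\eta$ along $\{V^u_{\le-1}(\omega^-)\times\{t\}\}_{\omega^-\in\Sigma^-,\,t\in X}$. Then $$\widehat h_{\widehat\eta}(\widehat F):=\limsup_{n\to\infty}\int\frac1n \mathrm H_{\eta_{(\omega^-,t)}}(\widehat{\mathcal C}_n)\,d\tau(\omega^-,t),\qquad \widehat P_{\widehat\eta}(\widehat\phi):=\widehat h_{\widehat\eta}(\widehat F)+\int\widehat\phi\,d\widehat\eta,$$ with $\mathrm H_\nu(\mathcal P)=-\sum_{A\in\mathcal P}\nu(A)\log\nu(A)$. Future independence: write $\widehat\eta=\int\widehat\eta_{\omega^-}\,d\eta^-(\omega^-)$ for the disintegration along $\{V^u_{\le-1}(\omega^-)\times X\}_{\omega^-\in\Sigma^-}$ and $\eta=\int\eta_{\omega^-}\,d\eta^-(\omega^-)$ for the disintegration of $\eta$ along $\{V^u_{\le-1}(\omega^-)\}_{\omega^-\in\Sigma^-}$, where $\eta^-$ is the projection of $\eta$ to $\Sigma^-$. $\widehat\eta$ is future independent if for $\eta^-$-a.e. $\omega^-$ the measure $\widehat\eta_{\omega^-}$ is the product of $\eta_{\omega^-}$ on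 $V^u_{\le-1}(\omega^-)$ and some Borel probability measure $\sigma_{\omega^-}$ on $X$. *)

(* Defs.v *)
From HB Require Import structures.
From mathcomp Require Import all_boot all_order all_algebra.
From mathcomp Require Import all_classical all_reals all_analysis.

Set Implicit Arguments.
Unset Strict Implicit.
Unset Printing Implicit Defensive.

Import Order.TTheory GRing.Theory Num.Theory.
Import numFieldNormedType.Exports.

Local Open Scope classical_set_scope.
Local Open Scope ring_scope.

(* measurableType is pointed, hence so are the spaces below.  A space that
   carries a probability measure is nonempty, so no generality is lost. *)
#[short(type="pmetricType")]
HB.structure Definition PMetric (K : numDomainType) :=
  { M of Metric K M & Pointed M }.

Notation borel T := (g_sigma_algebraType (@open T)).

(* coord_dist x y = 2^-n for the largest n such that x and y have the same
   coordinates at all indices of depth < n, and 0 if there is no largest n. *)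
Section Coordinate_distance.
Variables (R : realType) (I A T : Type) (depth : I -> nat) (coord : T -> I -> A).

Definition agree (n : nat) (x y : T) :=
  forall i, (depth i < n)%N -> coord x i = coord y i.

Definition coord_dist (x y : T) : R :=
  inf [set (2^-1 : R) ^+ n | n in [set n | agree n x y]].

Let half_ge0 n : 0 <= (2^-1 : R) ^+ n.
Proof. by rewrite exprn_ge0. Qed.

Let half_lt1 : (2^-1 : R) < 1.
Proof. by rewrite invf_lt1 ?ltr1n. Qed.

Let coord_dist_le n (x y : T) : agree n x y -> coord_dist x y <= 2^-1 ^+ n.
Proof.
move=> xy; apply: ge_inf; last by exists n.
by exists 0 => _ [m _ <-].
Qed.

Let le_coord_dist (e : R) (x y : T) :
  (forall n, agree n x y -> e <= 2^-1 ^+ n) -> e <= coord_dist x y.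
Proof.
move=> exy; apply: lb_le_inf; last by move=> _ [n /exy ? <-].
by exists 1; exists 0%N.
Qed.

Lemma coord_dist_agree n (x y : T) : coord_dist x y < 2^-1 ^+ n -> agree n x y.
Proof.
move=> xyn; apply: contrapT => nxy; move: xyn.
rewrite ltNge => /negP; apply; apply: le_coord_dist => m mxy.
rewrite ler_wiXn2l// ?(ltW half_lt1)// leqNgt; apply/negP => nm.
by apply: nxy => i ni; apply: mxy; exact: ltn_trans nm.
Qed.

Lemma coord_distxx (x : T) : coord_dist x x = 0.
Proof.
apply/eqP; rewrite eq_le le_coord_dist ?andbT//.
apply/ler_addgt0Pl => e e0; rewrite addr0.
have : (fun n => (2^-1 : R) ^+ n) @ \oo --> (0 : R).
  by apply: cvg_expr; rewrite ger0_norm.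
move/cvgrPdist_lt => /(_ _ e0)[N _ /(_ N (leqnn N))].
rewrite /= sub0r normrN ger0_norm// => /ltW; apply: le_trans.
exact: coord_dist_le.
Qed.

Lemma coord_dist_positivity : injective coord ->
  forall x y, coord_dist x y = 0 -> x = y.
Proof.
move=> inj x y xy0; apply: inj; apply/funext => i.
by apply: (@coord_dist_agree (depth i).+1 x y) => //; rewrite xy0 exprn_gt0.
Qed.

Lemma coord_dist_sym (x y : T) : coord_dist x y = coord_dist y x.
Proof.
by congr inf; apply/seteqP; split => r [n nxy <-]; exists n => //= i ni;
  rewrite nxy.
Qed.

Lemma coord_dist_triangle (y x z : T) :
  coord_dist x z <= coord_dist x y + coord_dist y z.
Proof.
rewrite -lerBlDr; apply: le_coord_dist => n xyn.
rewrite lerBlDr addrC -lerBlDr; apply: le_coord_dist => m yzm.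
rewrite lerBlDr; have [nm|mn] := leqP n m.
  rewrite (@le_trans _ _ (2^-1 ^+ n))// ?lerDr//.
  apply: coord_dist_le => i ni.
  by rewrite xyn// yzm//; exact: leq_trans nm.
rewrite (@le_trans _ _ (2^-1 ^+ m))// ?lerDl//.
apply: coord_dist_le => i mi.
by rewrite xyn ?yzm//; exact: ltn_trans mn.
Qed.

End Coordinate_distance.

Section Holder.
Variables (R : realType) (T U : Type) (dT : T -> T -> R) (dU : U -> U -> R).

Definition holder (a : R) (f : T -> U) :=
  exists C : R, forall x y, dU (f x) (f y) <= C * dT x y `^ a.

Definition holder_continuous (f : T -> U) := exists2 a : R, 0 < a & holder a f.

End Holder.

(* The uniform distance, with which the space of alpha-Holder maps is endowed. *)
Definition sup_dist (R : realType) (T : Type) (X : metricType R)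
  (f g : T -> X) : R := sup (range (fun t => mdist (f t) (g t))).

Definition prod_dist (R : realType) (X Y : metricType R) (x y : X * Y) : R :=
  Num.max (mdist x.1 y.1) (mdist x.2 y.2).

Definition homeomorphism (X Y : topologicalType) (f : X -> Y) :=
  continuous f /\ exists g : Y -> X, [/\ continuous g, cancel f g & cancel g f].

Definition topologically_transitive (X : topologicalType) (f : X -> X) :=
  forall U V : set X, open U -> open V -> U !=set0 -> V !=set0 ->
    exists n : nat, U `&` iter n f @^-1` V !=set0.

Section Entropy.
Variables (d : measure_display) (T : measurableType d) (R : realType).
Implicit Types (mu : set T -> \bar R) (f : T -> T) (I : finType).

Definition invariant_measure mu f :=
  forall B, measurable B -> mu (f @^-1` B) = mu B.

Definition measurable_partition I (P : I -> set T) :=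
  [/\ forall i, measurable (P i), trivIset [set: I] P &
      \bigcup_i P i = [set: T]].

(* ln 0 = 0, so null atoms contribute 0. *)
Definition partition_entropy mu I (P : I -> set T) : R :=
  - \sum_(i : I) fine (mu (P i)) * ln (fine (mu (P i))).

(* The join of the preimages of P under the iterates of f of order < n; its
   atoms are indexed by the words of length n in the indices of P. *)
Definition iterated_join f I (P : I -> set T) (n : nat)
    (w : {ffun 'I_n -> I}) : set T :=
  \bigcap_(i : 'I_n) iter i f @^-1` P (w i).

(* For invariant mu the upper limit is a limit, by subadditivity. *)
Definition partition_metric_entropy mu f I (P : I -> set T) : \bar R :=
  limn_esup (fun n =>
    (n%:R^-1 * partition_entropy mu (iterated_join f P (n := n)))%:E).

Definition metric_entropy mu f : \bar R :=
  ereal_sup [set h | exists k (P : 'I_k -> set T),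
    measurable_partition P /\ h = partition_metric_entropy mu f P].

End Entropy.

(* k is a family of conditional probabilities of mu along the partition of Z
   into the fibers of q : Z -> Y, with quotient measure q_* mu. *)
Definition disintegration (R : realType) (dZ dY : measure_display)
    (Z : measurableType dZ) (Y : measurableType dY)
    (mu : set Z -> \bar R) (q : Z -> Y) (k : R.-pker Y ~> Z) :=
  (forall B, measurable B -> mu B = \int[pushforward mu q]_y k y B)%E /\
  {ae pushforward mu q, forall y, k y (q @^-1` [set y]) = 1%E}.

(* A nonempty two-sided topological Markov shift, given by its transition
   relation.  The point only serves to make the shift space pointed. *)
Record markov_shift := MarkovShift {
  symbol : finType;
  transition : rel symbol;
  markov_point : int -> symbol;
  markov_pointP :
    forall i, transition (markov_point i) (markov_point (i + 1)) }.

Section Markov_shift.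
Variables (R : realType) (S : markov_shift).

Definition admissible : set (int -> symbol S) :=
  [set w | forall i, transition (w i) (w (i + 1))].

(* R is the codomain of the distance. *)
Definition shift_space : Type := let _ := R in set_type admissible.

HB.instance Definition _ := Choice.on shift_space.

Definition letter (w : shift_space) : int -> symbol S := \val w.

Lemma letter_inj : injective letter.
Proof. exact: val_inj. Qed.

Lemma letterP w : admissible (letter w).
Proof. exact: set_valP. Qed.

Definition mk_shift (w : int -> symbol S) (hw : admissible w) : shift_space :=
  exist _ w (mem_set hw).

HB.instance Definition _ :=
  isPointed.Build shift_space (mk_shift (@markov_pointP S)).

HB.instance Definition _ := isMetric.Build R shift_space
  (@coord_distxx R _ _ _ absz letter)
  (@coord_dist_positivity R _ _ _ absz letter letter_inj)
  (@coord_dist_sym R _ _ _ absz letter) (@coord_dist_triangle R _ _ _ absz letter).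

Let shift_admissible (w : shift_space) :
  admissible (fun i => letter w (i + 1)).
Proof. by move=> i; exact: letterP. Qed.

Definition left_shift (w : shift_space) : shift_space :=
  mk_shift (shift_admissible w).

(* Negz k = - k - 1, so k stands for the index - k - 1. *)
Definition past_space : Type :=
  let _ := R in set_type (range (fun w : shift_space => letter w \o Negz)).

HB.instance Definition _ := Choice.on past_space.

Definition past_letter (p : past_space) : nat -> symbol S := \val p.

Lemma past_letter_inj : injective past_letter.
Proof. exact: val_inj. Qed.

(* The fibers of past are the local unstable sets V^u_{<= -1}. *)
Definition past (w : shift_space) : past_space :=
  exist _ (letter w \o Negz) (mem_set (imageT _ w)).

HB.instance Definition _ := isPointed.Build past_space (past point).

HB.instance Definition _ := isMetric.Build R past_space
  (@coord_distxx R _ _ _ id past_letter)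
  (@coord_dist_positivity R _ _ _ id past_letter past_letter_inj)
  (@coord_dist_sym R _ _ _ id past_letter) (@coord_dist_triangle R _ _ _ id past_letter).

End Markov_shift.

Section Skew_product.
Variables (R : realType) (S : markov_shift) (X : pmetricType R).
Variable F : shift_space R S -> X -> X.

Notation Sigma := (shift_space R S).
Notation Past := (past_space R S).

(* By second countability the product sigma-algebra below is the Borel
   sigma-algebra of the product space. *)
Notation SigmaX := (borel Sigma * borel X)%type.
Notation PastX := (borel Past * borel X)%type.

Definition skew_product (z : SigmaX) : SigmaX := (left_shift z.1, F z.1 z.2).

Definition past_fst (z : SigmaX) : borel Past := past z.1.

Definition past_prod (z : SigmaX) : PastX := (past z.1, z.2).

Definition cylinder_prod (a : symbol S) : set SigmaX :=
  [set w | letter w 0 = a] `*` [set: X].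

Variable eta : probability SigmaX R.

Definition base_measure : set (borel Sigma) -> \bar R := pushforward eta fst.

Definition fiber_entropy : \bar R :=
  (metric_entropy eta skew_product
     - metric_entropy base_measure (@left_shift R S : borel Sigma -> borel Sigma))%E.

Definition metric_pressure (phi : SigmaX -> R) : \bar R :=
  (metric_entropy eta skew_product + \int[eta]_z (phi z)%:E)%E.

(* Here k is the disintegration of eta along past_prod. *)
Definition entropy_out (k : R.-pker PastX ~> SigmaX) : \bar R :=
  limn_esup (fun n => \int[pushforward eta past_prod]_y
    (n%:R^-1 * partition_entropy (k y)
       (iterated_join skew_product cylinder_prod (n := n)))%:E)%E.

Definition pressure_out (k : R.-pker PastX ~> SigmaX) (phi : SigmaX -> R) :
  \bar R := (entropy_out k + \int[eta]_z (phi z)%:E)%E.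

(* Here kX is the disintegration of eta along past_fst and k is that of
   base_measure along past. *)
Definition future_independent (kX : R.-pker borel Past ~> SigmaX)
    (k : R.-pker borel Past ~> borel Sigma) :=
  {ae pushforward eta past_fst, forall p,
    exists sigma : probability (borel X) R,
      forall B, measurable B -> kX p B = (k p \x sigma)%E B}.

End Skew_product.

(* Main.v *)
Require Import Defs.
From HB Require Import structures.
From mathcomp Require Import all_boot all_order all_algebra.
From mathcomp Require Import all_classical all_reals all_analysis.
From mathcomp Require Import measurable_realfun zify ring lra.

Set Implicit Arguments.
Unset Strict Implicit.
Unset Printing Implicit Defensive.

Import Order.TTheory GRing.Theory Num.Theory.
Import numFieldNormedType.Exports.

Local Open Scope classical_set_scope.
Local Open Scope ring_scope.

(* Put C for the partition by the letter of index 0, a n (resp. b n, c n) for the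
   entropy of the first n letters given the past and the point of X (resp. given
   the past, unconditionally); then a <= b <= c.  Since F_w depends on the letters
   of index <= 0 only, the past and the point after n steps are functions of the
   initial ones and of the n letters read, so a is subadditive; stationarity makes
   b n <= n lim (c m / m).  Hence lim (a n / n) <= lim (c n / n) <= h(T) <= h(F),
   and equality throughout forces a n = b n for all n, which by strict concavity of
   the entropy says that, given the past, the future letters are independent of the
   point of X.  Conversely, future independence gives a = b, and b n >= n h(T) by
   the Kolmogorov-Sinai theorem.
   Conditional entropies are integrals over a disintegration; everything is
   transferred to finite partitions, because such an integral is the infimum of the
   conditional entropies given finite partitions measurable with respect to the
   quotient map; both bounds are instances of Gibbs' inequality. *)

(** * Entropy of functions with finitely many values *)

(** Equality of upper limits says nothing about a fixed n, whereas independence has to be read off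
    from [b n <= a n] for each n. It is available because the two sequences err on opposite sides:
    subadditivity places [a n / n] above its own upper limit, stationarity places [b n / n] below
    that of [c]. Additivity and stationarity are proved for finite partitions only; an integral over
    a disintegration is bounded by every finite conditional entropy and reached by some of them up
    to an error e. In the same spirit martingale convergence is avoided: the sets approximated by
    past blocks, or by windows, are shown to form a sigma-algebra. To return from entropies to
    measures, independence is tested on a countable pi-system of cylinders times open sets, so that
    all exceptional null sets can be united. *)

Section Finite_entropy.
Variable R : realType.

(** Divided by [x], this is [ln (1 + t) <= t] at [t = y / x - 1]. As [ln 0 = 0] by convention, the
    last hypothesis excludes [y = 0 < x], where the left side ought to be minus infinity. *)
Lemma mulr_ln_le (x y : R) : 0 <= x -> 0 <= y -> (y = 0 -> x = 0) ->
  x * ln y <= x * ln x + (y - x).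
Proof.
rewrite le_eqVlt => /predU1P[<- y0 _|x0 y0 yx]; first by rewrite !mul0r add0r subr0.
have {}y0 : 0 < y.
  by rewrite lt_neqAle y0 andbT; apply/eqP => /esym/yx xe; rewrite xe ltxx in x0.
have : ln (1 + (y / x - 1)) <= y / x - 1.
  by apply: le_ln1Dx; rewrite ltrBDr addNr divr_gt0.
rewrite addrC subrK ln_div// => h.
have -> : y - x = x * (y / x - 1) by field; rewrite gt_eqF.
by rewrite -mulrDr ler_pM2l// -lerBlDl.
Qed.

(** Rigidity comes from the strict inequality [1 + t < expR t] for nonzero [t], applied to
    [t = ln (y / x)]. *)
Lemma mulr_ln_eq (x y : R) : 0 <= x -> 0 <= y -> (y = 0 -> x = 0) ->
  x * ln y = x * ln x + (y - x) -> x = y.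
Proof.
rewrite le_eqVlt => /predU1P[<- y0 _|x0 y0 yx]; first by rewrite !mul0r add0r subr0.
have {}y0 : 0 < y.
  by rewrite lt_neqAle y0 andbT; apply/eqP => /esym/yx xe; rewrite xe ltxx in x0.
have -> : y - x = x * (y / x - 1) by field; rewrite gt_eqF.
rewrite -mulrDr => /(mulfI (lt0r_neq0 x0)) h.
have {}h : 1 + ln (y / x) = y / x by rewrite ln_div// h; ring.
have [/eqP|/expR_gt1Dx] := eqVneq (ln (y / x)) 0.
  rewrite ln_eq0 ?divr_gt0// => /eqP e.
  by rewrite -[y](divfK (lt0r_neq0 x0)) e mul1r.
by rewrite lnK ?posrE ?divr_gt0// h ltxx.
Qed.

(** The total masses need only be comparable, because code weights that are merely subnormalised
    will serve as [q]. *)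
Lemma gibbs (I : finType) (p q : I -> R) :
  (forall i, 0 <= p i) -> (forall i, 0 <= q i) -> (forall i, q i = 0 -> p i = 0) ->
  \sum_i q i <= \sum_i p i ->
  \sum_i p i * ln (q i) <= \sum_i p i * ln (p i).
Proof.
move=> p0 q0 qp sqp.
apply: (@le_trans _ _ (\sum_i (p i * ln (p i) + (q i - p i)))).
  by apply: ler_sum => i _; apply: mulr_ln_le => //; exact: qp.
by rewrite big_split/= gerDl sumrB subr_le0.
Qed.

Lemma gibbs_eq (I : finType) (p q : I -> R) :
  (forall i, 0 <= p i) -> (forall i, 0 <= q i) -> (forall i, q i = 0 -> p i = 0) ->
  \sum_i q i <= \sum_i p i ->
  \sum_i p i * ln (p i) <= \sum_i p i * ln (q i) -> p =1 q.
Proof.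
move=> p0 q0 qp sqp pq i.
(* The termwise defect is nonnegative and has nonpositive sum, hence vanishes everywhere. *)
pose d i := p i * ln (p i) + (q i - p i) - p i * ln (q i).
have d0 j : 0 <= d j by rewrite subr_ge0 mulr_ln_le//; exact: qp.
have : \sum_j d j <= 0.
  rewrite sumrB big_split/= sumrB; lra.
move=> sd; have /eqP : \sum_j d j = 0 by apply/eqP; rewrite eq_le sd sumr_ge0.
rewrite psumr_eq0// => /allP/(_ i (mem_index_enum _)) /=.
by rewrite subr_eq0 => /eqP/esym; apply: mulr_ln_eq => //; exact: qp.
Qed.

End Finite_entropy.

Section Random_variable.
Context d (T : measurableType d).

(** A finite partition is represented by a function with finitely many values: joins become pairs,
    and [g] refines [f] when [g z = g z'] implies [f z = f z']. *)
Definition fin_measurable (I : finType) (f : T -> I) :=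
  forall i, measurable (f @^-1` [set i]).

Lemma fin_measurable_preimage (I : finType) (f : T -> I) (B : set I) :
  fin_measurable f -> measurable (f @^-1` B).
Proof.
move=> mf; rewrite (_ : _ @^-1` _ = \bigcup_(i in B) f @^-1` [set i]).
  by apply: fin_bigcup_measurable => [|i _]; [exact: finite_finset|exact: mf].
by apply/seteqP; split => [z Bz|z [i Bi /= zi]]; [exists (f z)|rewrite /= zi].
Qed.

Lemma fin_measurable_comp (I J : finType) (u : I -> J) (f : T -> I) :
  fin_measurable f -> fin_measurable (fun z => u (f z)).
Proof.
move=> mf j; rewrite (_ : _ @^-1` _ = f @^-1` (u @^-1` [set j]))//.
exact: fin_measurable_preimage.
Qed.

Lemma fin_measurable_cst (I : finType) (i : I) : fin_measurable (fun=> i).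
Proof. by move=> j; rewrite preimage_cst; case: ifP. Qed.

Lemma fin_measurable_pair (I J : finType) (f : T -> I) (g : T -> J) :
  fin_measurable f -> fin_measurable g -> fin_measurable (fun z => (f z, g z)).
Proof.
move=> mf mg [i j]; rewrite (_ : _ @^-1` _ = f @^-1` [set i] `&` g @^-1` [set j]).
  exact: measurableI.
by apply/seteqP; split => z /= [-> ->].
Qed.

Lemma fin_measurable_ffun (J I : finType) (f : J -> T -> I) :
  (forall j, fin_measurable (f j)) -> fin_measurable (fun z => [ffun j => f j z]).
Proof.
move=> mf w; rewrite (_ : _ @^-1` _ =
    \bigcap_(j in [set` index_enum J]) f j @^-1` [set w j]).
  apply: fin_bigcap_measurable => // j _; exact: mf.
apply/seteqP; split => [z /= <- j _|z h /=]; first by rewrite /= ffunE.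
by apply/ffunP => j; rewrite ffunE; apply: h; rewrite /= mem_index_enum.
Qed.

Lemma fin_measurable_bool (A : set T) :
  measurable A -> fin_measurable (fun z => `[<A z>]).
Proof.
move=> mA [].
  rewrite (_ : _ @^-1` _ = A)//; apply/seteqP.
  by split => z /=; [move/asboolP|move=> ?; exact/asboolP].
rewrite (_ : _ @^-1` _ = ~` A); first exact: measurableC.
by apply/seteqP; split => z /=; [move/asboolPn|move=> ?; exact/asboolPn].
Qed.

Section Law.
Variables (R : realType) (mu : {measure set T -> \bar R}).
Hypothesis mu1 : mu [set: T] = 1%E.

Lemma measure1_fin A : measurable A -> mu A \is a fin_num.
Proof.
move=> mA; rewrite ge0_fin_numE ?measure_ge0//.
by rewrite (@le_lt_trans _ _ 1%E) ?ltry// -mu1 le_measure ?inE.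
Qed.

Lemma law_sum (J : finType) (g : T -> J) (A : set T) :
  fin_measurable g -> measurable A ->
  fine (mu A) = \sum_j fine (mu (A `&` g @^-1` [set j])).
Proof.
move=> mg mA.
have mAg j : measurable (A `&` g @^-1` [set j]) by apply: measurableI => //; exact: mg.
rewrite (eq_bigr (fun j => fine (mu (A `&` g @^-1` [set j]))))// sum_fine; last by move=> j _; exact: measure1_fin.
congr fine; rewrite (fsbig_seq _ _ (index_enum_uniq J)) -measure_fin_bigcup//.
- congr (mu _); apply/seteqP; split => [z Az|z [j _ []]//].
  by exists (g z) => //=; rewrite mem_index_enum.
- by move=> i j _ _ [z [[_ /= <-] [_ /= <-]]].
Qed.

Definition law (I : finType) (f : T -> I) (i : I) : R :=
  fine (mu (f @^-1` [set i])).

Definition ent (I : finType) (f : T -> I) : R :=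
  partition_entropy mu (fun i => f @^-1` [set i]).

Lemma entE (I : finType) (f : T -> I) :
  ent f = - \sum_i law f i * ln (law f i).
Proof. by []. Qed.

Lemma law_ge0 (I : finType) (f : T -> I) i : 0 <= law f i.
Proof. by rewrite fine_ge0. Qed.

Lemma sum_law (I : finType) (f : T -> I) : fin_measurable f -> \sum_i law f i = 1.
Proof.
move=> mf; have := law_sum mf measurableT; rewrite mu1 /= => ->.
by apply: eq_bigr => i _; rewrite setTI.
Qed.

Lemma law_le1 (I : finType) (f : T -> I) i : fin_measurable f -> law f i <= 1.
Proof.
by move=> mf; rewrite -(sum_law mf) (bigD1 i)//= lerDl sumr_ge0// => j _; exact: law_ge0.
Qed.

Lemma law_comp (I J : finType) (u : I -> J) (f : T -> I) j : fin_measurable f ->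
  law (fun z => u (f z)) j = \sum_(i | u i == j) law f i.
Proof.
move=> mf; rewrite /law (law_sum mf); last exact: (fin_measurable_comp u mf).
rewrite [RHS]big_mkcond; apply: eq_bigr => i _; case: eqP => [uij|uij].
  by congr (fine (mu _)); apply/seteqP; split => [z []//|z /= zi]; split => //=; rewrite zi.
rewrite (_ : _ `&` _ = set0) ?measure0//; apply/seteqP; split => z //= [] + zi.
by rewrite zi.
Qed.

Lemma law_pairl (I J : finType) (f : T -> I) (g : T -> J) i :
  fin_measurable f -> fin_measurable g ->
  law f i = \sum_j law (fun z => (f z, g z)) (i, j).
Proof.
move=> mf mg; rewrite /law (law_sum mg (mf i)).
apply: eq_bigr => j _; congr (fine (mu _)).
by apply/seteqP; split => z /= [-> ->].
Qed.

Lemma law_pairr (I J : finType) (f : T -> I) (g : T -> J) j :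
  fin_measurable f -> fin_measurable g ->
  law g j = \sum_i law (fun z => (f z, g z)) (i, j).
Proof.
move=> mf mg; rewrite /law (law_sum mf (mg j)).
apply: eq_bigr => i _; congr (fine (mu _)).
by apply/seteqP; split => z /= [-> ->].
Qed.

Lemma ent_comp_le (I J : finType) (u : I -> J) (f : T -> I) : fin_measurable f ->
  ent (fun z => u (f z)) <= ent f.
Proof.
move=> mf; rewrite !entE lerN2.
(* Each atom weighs at most as much as the fiber of [u] containing it, and [ln] is monotone. *)
rewrite [leRHS](_ : _ = \sum_i law f i * ln (law (fun z => u (f z)) (u i))).
  apply: ler_sum => i _; have := law_ge0 f i; rewrite le_eqVlt.
  move=> /predU1P[<-|fi0]; first by rewrite !mul0r.
  rewrite ler_pM2l// ler_ln ?posrE//.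
    by rewrite law_comp// (bigD1 i)//= lerDl sumr_ge0// => k _; exact: law_ge0.
  by rewrite law_comp// (bigD1 i)//= ltr_pwDl// sumr_ge0// => k _; exact: law_ge0.
rewrite (partition_big u xpredT)//=; apply: eq_bigr => j _.
by rewrite {1}law_comp// mulr_suml; apply: eq_bigr => i /eqP <-.
Qed.

Lemma ent_determined_le (I J : finType) (f : T -> I) (g : T -> J) :
  fin_measurable g -> (forall z z', g z = g z' -> f z = f z') -> ent f <= ent g.
Proof.
move=> mg gf; pose u j := f (xget point [set z | g z = j]).
rewrite (_ : f = fun z => u (g z)); first exact: ent_comp_le.
apply/funext => z; apply: gf; rewrite /u.
by case: xgetP => [z' _ /= ->//|/(_ z)/(_ erefl)].
Qed.

Lemma ent_determined (I J : finType) (f : T -> I) (g : T -> J) :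
  fin_measurable f -> fin_measurable g ->
  (forall z z', g z = g z' <-> f z = f z') -> ent f = ent g.
Proof.
move=> mf mg fg; apply/eqP; rewrite eq_le !ent_determined_le// => z z' /fg//.
Qed.

Section Submodularity.
Variables (I J K : finType) (f : T -> I) (g : T -> J) (e : T -> K).
Hypotheses (mf : fin_measurable f) (mg : fin_measurable g) (me : fin_measurable e).

Let m (x : I * J * K) := law (fun z => (f z, g z, e z)) x.
Let mfe x := law (fun z => (f z, e z)) x.
Let mge x := law (fun z => (g z, e z)) x.
Let me' x := law e x.

Let mm : fin_measurable (fun z => (f z, g z, e z)).
Proof. by apply: fin_measurable_pair me; exact: fin_measurable_pair. Qed.

(** The law under which [f] and [g] are conditionally independent given [e]. Where [me'] vanishes it
    is 0, since division by 0 gives 0. *)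
Let q (x : I * J * K) := mfe (x.1.1, x.2) * mge (x.1.2, x.2) / me' x.2.

Let mfeE i k : mfe (i, k) = \sum_j m (i, j, k).
Proof.
rewrite /mfe (law_pairl _ (fin_measurable_pair mf me) mg).
apply: eq_bigr => j _; congr (fine (mu _)).
by apply/seteqP; split => z /= [-> -> ->].
Qed.

Let mgeE j k : mge (j, k) = \sum_i m (i, j, k).
Proof.
rewrite /mge (law_pairr _ mf (fin_measurable_pair mg me)).
apply: eq_bigr => i _; congr (fine (mu _)).
by apply/seteqP; split => z /= [-> -> ->].
Qed.

Let meE k : me' k = \sum_i mfe (i, k).
Proof. exact: law_pairr. Qed.

Let meE' k : me' k = \sum_j mge (j, k).
Proof. exact: law_pairr. Qed.

Let m_ge0 x : 0 <= m x. Proof. exact: law_ge0. Qed.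
Let mfe_ge0 x : 0 <= mfe x. Proof. exact: law_ge0. Qed.
Let mge_ge0 x : 0 <= mge x. Proof. exact: law_ge0. Qed.
Let me_ge0 x : 0 <= me' x. Proof. exact: law_ge0. Qed.

Let m_gt0 i j k : 0 < m (i, j, k) ->
  [/\ 0 < mfe (i, k), 0 < mge (j, k) & 0 < me' k].
Proof.
move=> h.
have h1 : 0 < mfe (i, k) by rewrite mfeE (bigD1 j)//= ltr_pwDl// sumr_ge0.
have h2 : 0 < mge (j, k) by rewrite mgeE (bigD1 i)//= ltr_pwDl// sumr_ge0.
by split => //; rewrite meE (bigD1 i)//= ltr_pwDl// sumr_ge0.
Qed.

Let q_ge0 x : 0 <= q x. Proof. by rewrite /q divr_ge0// mulr_ge0. Qed.

Let q_eq0 x : q x = 0 -> m x = 0.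
Proof.
case: x => -[i j] k q0; apply/eqP; rewrite eq_le m_ge0 andbT leNgt.
apply/negP => /m_gt0 [h1 h2 h3]; move: q0; rewrite /q /=.
by apply/eqP; rewrite gt_eqF// divr_gt0// mulr_gt0.
Qed.

Let sum_pair (A B : finType) (F : A * B -> R) :
  \sum_x F x = \sum_a \sum_b F (a, b).
Proof. by rewrite pair_bigA; apply: eq_bigr => -[]. Qed.

Let sum3 (F : I * J * K -> R) : \sum_x F x = \sum_i \sum_j \sum_k F (i, j, k).
Proof.
by rewrite !sum_pair.
Qed.

Let sum_q : \sum_x q x <= \sum_x m x.
Proof.
rewrite (sum_law mm) -(sum_law me) sum3 exchange_big/=.
under eq_bigr do rewrite exchange_big/=.
rewrite exchange_big/=; apply: ler_sum => k _.
rewrite /q/=; under eq_bigr do rewrite -mulr_suml -mulr_suml -meE.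
rewrite -mulr_suml -mulr_sumr -meE'.
rewrite [leRHS]/(me' k); have := me_ge0 k; rewrite le_eqVlt => /predU1P[<-|h].
  by rewrite mul0r mul0r.
by rewrite mulfK// gt_eqF.
Qed.

Let sum_mq : \sum_x m x * ln (q x) =
  ent e - ent (fun z => (f z, e z)) - ent (fun z => (g z, e z)).
Proof.
transitivity (\sum_x m x * (ln (mfe (x.1.1, x.2)) + ln (mge (x.1.2, x.2)) - ln (me' x.2))).
  apply: eq_bigr => -[[i j] k] _; have := m_ge0 (i, j, k).
  rewrite le_eqVlt => /predU1P[<-|h]; first by rewrite !mul0r.
  have [h1 h2 h3] := m_gt0 h.
  by rewrite /q/= ln_div ?posrE ?mulr_gt0// lnM.
under eq_bigr do rewrite mulrBr mulrDr.
rewrite sumrB big_split/= !entE.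
have -> : \sum_x m x * ln (mfe (x.1.1, x.2)) = \sum_x mfe x * ln (mfe x).
  rewrite [RHS]sum_pair sum3.
  apply: eq_bigr => i _; rewrite exchange_big/=; apply: eq_bigr => k _.
  by rewrite [X in _ = X * _]mfeE mulr_suml.
have -> : \sum_x m x * ln (mge (x.1.2, x.2)) = \sum_x mge x * ln (mge x).
  rewrite [RHS]sum_pair sum3 exchange_big/=; apply: eq_bigr => j _.
  rewrite exchange_big/=; apply: eq_bigr => k _.
  by rewrite [X in _ = X * _]mgeE mulr_suml.
have -> : \sum_x m x * ln (me' x.2) = \sum_x me' x * ln (me' x).
  rewrite sum3; under eq_bigr do rewrite exchange_big/=.
  rewrite exchange_big/=; apply: eq_bigr => k _.
  rewrite [X in _ = X * _]meE mulr_suml; apply: eq_bigr => i _.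
  by rewrite mfeE mulr_suml.
ring.
Qed.

(** Nonnegativity of the conditional mutual information of [f] and [g] given [e]: Gibbs' inequality
    for the joint law against [q]. *)
Lemma ent_submodular :
  ent (fun z => (f z, g z, e z)) + ent e <=
  ent (fun z => (f z, e z)) + ent (fun z => (g z, e z)).
Proof.
have := gibbs m_ge0 q_ge0 q_eq0 sum_q.
rewrite sum_mq [ent (fun z => (f z, g z, e z))]entE; lra.
Qed.

(** Zero conditional mutual information is the equality case of Gibbs' inequality, which forces the
    joint law to be [q]. *)
Lemma ent_modular i j k :
  ent (fun z => (f z, e z)) + ent (fun z => (g z, e z)) <=
    ent (fun z => (f z, g z, e z)) + ent e ->
  law (fun z => (f z, g z, e z)) (i, j, k) =
    law (fun z => (f z, e z)) (i, k) * law (fun z => (g z, e z)) (j, k) / law e k.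
Proof.
move=> h; apply: (gibbs_eq m_ge0 q_ge0 q_eq0 sum_q).
rewrite sum_mq; move: h; rewrite [ent (fun z => (f z, g z, e z))]entE; lra.
Qed.

End Submodularity.
End Law.
End Random_variable.

(** * Conditional entropy given a finite partition *)

Section Conditional_entropy.
Context d (T : measurableType d) (R : realType) (mu : {measure set T -> \bar R}).
Hypothesis mu1 : mu [set: T] = 1%E.

Definition cent (I J : finType) (f : T -> I) (g : T -> J) : R :=
  ent mu (fun z => (f z, g z)) - ent mu g.

Section Basic.
Variables (I J K : finType) (f : T -> I) (g : T -> J) (e : T -> K).
Hypotheses (mf : fin_measurable f) (mg : fin_measurable g) (me : fin_measurable e).

Lemma cent_ge0 : 0 <= cent f g.
Proof.
rewrite subr_ge0; apply: ent_determined_le => //.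
  exact: fin_measurable_pair.
by move=> z z' [].
Qed.

Lemma cent_determined_le :
  (forall z z', e z = e z' -> f z = f z') -> cent f g <= cent e g.
Proof.
move=> ef; rewrite lerB//; apply: ent_determined_le => //.
  exact: fin_measurable_pair.
by move=> z z' [/ef -> ->].
Qed.

Lemma cent_le_ent : cent f g <= ent mu f.
Proof.
rewrite lerBlDr.
(* Relative to a constant function, submodularity becomes subadditivity. *)
have mt : fin_measurable (fun _ : T => tt) by exact: fin_measurable_cst.
have := ent_submodular mu1 mf mg mt.
rewrite (ent_determined mu1 (f := fun z => (f z, g z, tt)) (g := fun z => (f z, g z))).
- rewrite (ent_determined mu1 (f := fun z => (f z, tt)) (g := f))//.
  + rewrite (ent_determined mu1 (f := fun z => (g z, tt)) (g := g))//.
    * have h : 0 <= ent mu (fun _ : T => tt).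
        rewrite entE oppr_ge0 sumr_le0// => i _.
        by rewrite mulr_ge0_le0 ?law_ge0// ln_le0// law_le1.
      by lra.
    * exact: fin_measurable_pair.
    * by move=> z z'; split => [->|[]].
  + exact: fin_measurable_pair.
  + by move=> z z'; split => [->|[]].
- by apply: fin_measurable_pair => //; exact: fin_measurable_pair.
- exact: fin_measurable_pair.
- by move=> z z'; split => [[-> ->]|[-> ->]].
Qed.

Lemma cent_pair_le : cent (fun z => (f z, g z)) e <= cent f e + cent g e.
Proof. by have := ent_submodular mu1 mf mg me; rewrite /cent; lra. Qed.

(** Triangle inequality, by which approximations can be composed: [f] by [g], then [g] by [e]. *)
Lemma cent_trans : cent f e <= cent f g + cent g e.
Proof.
have := ent_submodular mu1 mf me mg.
have : ent mu (fun z => (f z, e z)) <= ent mu (fun z => (f z, e z, g z)).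
  apply: ent_determined_le => //; last by move=> z z' [-> ->].
  by apply: fin_measurable_pair => //; exact: fin_measurable_pair.
have -> : ent mu (fun z => (e z, g z)) = ent mu (fun z => (g z, e z)).
  apply: ent_determined => //; try exact: fin_measurable_pair.
  by move=> z z'; split => [[-> ->]|[-> ->]].
by rewrite /cent; lra.
Qed.

(** Submodularity with [e] a function of [g], so that the pair of both carries the same information
    as [g]. *)
Lemma cent_le_cond :
  (forall z z', g z = g z' -> e z = e z') -> cent f g <= cent f e.
Proof.
move=> ge; have := ent_submodular mu1 mf mg me.
rewrite (ent_determined mu1 (f := fun z => (f z, g z, e z)) (g := fun z => (f z, g z))).
- rewrite (ent_determined mu1 (f := fun z => (g z, e z)) (g := g))//.
  + by rewrite /cent; lra.
  + exact: fin_measurable_pair.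
  + by move=> z z'; split => [h|[->]//]; rewrite h (ge _ _ h).
- by apply: fin_measurable_pair => //; exact: fin_measurable_pair.
- exact: fin_measurable_pair.
- by move=> z z'; split => [[-> h]|[-> ->]//]; rewrite h (ge _ _ h).
Qed.

Lemma cent_determined_le0 : (forall z z', g z = g z' -> f z = f z') -> cent f g <= 0.
Proof.
move=> gf; rewrite subr_le0; apply: ent_determined_le => //.
by move=> z z' h; rewrite h (gf _ _ h).
Qed.

Lemma chain_rule : ent mu (fun z => (f z, g z)) = ent mu g + cent f g.
Proof. by rewrite addrC subrK. Qed.

End Basic.

Lemma cent_ffun_le (I J : finType) (f : nat -> T -> I) (g : T -> J) n :
  (forall i, fin_measurable (f i)) -> fin_measurable g ->
  cent (fun z => [ffun i : 'I_n => f i z]) g <= \sum_(i < n) cent (f i) g.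
Proof.
move=> mf mg; elim: n => [|n ih].
  rewrite big_ord0; apply: cent_determined_le0 => // z z' _.
  by apply/ffunP => -[].
rewrite big_ord_recr/=; apply: le_trans (lerD ih (lexx _)).
have mF : fin_measurable (fun z => [ffun i : 'I_n => f i z]).
  exact: fin_measurable_ffun.
apply: le_trans (cent_pair_le mF (mf n) mg); apply: cent_determined_le => //.
  exact: fin_measurable_pair.
move=> z z' [/ffunP h fn]; apply/ffunP => i; rewrite !ffunE.
have [->//|ni] := eqVneq (i : nat) n.
have lin : (i < n)%N by rewrite ltn_neqAle ni -ltnS ltn_ord.
by have := h (Ordinal lin); rewrite !ffunE.
Qed.

(** The indicators of its values together determine [f]; this reduces the approximation of
    partitions to that of sets. *)
Lemma cent_indicator_le (I J : finType) (f : T -> I) (g : T -> J) :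
  fin_measurable f -> fin_measurable g ->
  cent f g <= \sum_i cent (fun z => f z == i) g.
Proof.
move=> mf mg; pose F k z := nth (f point) (enum I) k == f z.
have mF k : fin_measurable (F k) by exact: (fin_measurable_comp (fun i => _ == i) mf).
have -> : \sum_i cent (fun z => f z == i) g = \sum_(k < #|I|) cent (F k) g.
  rewrite (reindex (@enum_val I xpredT))/=; last exact: onW_bij (@enum_val_bij I).
  apply: eq_bigr => k _; congr (cent _ g); apply/funext => z.
  by rewrite /F eq_sym (enum_val_nth (f point)).
apply: le_trans (cent_ffun_le _ mF mg); apply: cent_determined_le => //.
  exact: fin_measurable_ffun.
move=> z z' /ffunP/(_ (enum_rank (f z))); rewrite !ffunE/F.
by rewrite nth_enum_rank eqxx => /esym/eqP.
Qed.

End Conditional_entropy.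

(** * Approximation of sets by a refining sequence of partitions *)

Section Approximation.
Variable R : realType.

(** The left side is the conditional entropy of a set given a subset, [e] being the mass of the
    difference. With [s = Num.sqrt e], the terms in [y] cost at most [e <= s], and
    [- e * ln e = - 2 * s * (s * ln s)] at most [2 * s], whence the constant 3. *)
Lemma entropy_increment_le (y e : R) : 0 <= y -> 0 <= e -> y + e <= 1 ->
  (y + e) * ln (y + e) - y * ln y - e * ln e <= 3 * Num.sqrt e.
Proof.
move=> y0 e0 ye1.
have s0 : 0 <= Num.sqrt e by rewrite sqrtr_ge0.
have es : e = Num.sqrt e * Num.sqrt e by rewrite -expr2 sqr_sqrtr.
have s1 : Num.sqrt e <= 1.
  by rewrite -[leRHS]sqrtr1 ler_sqrt//; lra.
have le_s : e <= Num.sqrt e by rewrite {1}es ler_piMl.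
have h1 : y * ln (y + e) <= y * ln y + e.
  apply: le_trans (mulr_ln_le y0 (addr_ge0 y0 e0) _) _; last by lra.
  by move=> ye; lra.
have h2 : e * ln (y + e) <= 0 by rewrite mulr_ge0_le0// ln_le0.
have h3 : - (e * ln e) <= 2 * Num.sqrt e.
  move: s0; rewrite le_eqVlt => /predU1P[s0|s0].
    by rewrite {1}es -s0 mul0r mul0r mulr0 oppr0.
  have := @mulr_ln_le _ (Num.sqrt e) 1 (ltW s0) ler01.
  move=> /(_ _)/wrap[|]; first by move=> /eqP; rewrite oner_eq0.
  rewrite ln1 mulr0.
  set s := Num.sqrt e in s0 s1 es *.
  by rewrite es lnM ?posrE//; nra.
by rewrite mulrDl; lra.
Qed.

Context d (T : measurableType d) (mu : {measure set T -> \bar R}).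
Hypothesis mu1 : mu [set: T] = 1%E.

(** As [B] lies in [A], one entry of the two-by-two table of masses is 0, and the entropy can be
    computed explicitly. *)
Lemma cent_subset_le (A B : set T) : measurable A -> measurable B -> B `<=` A ->
  cent mu (fun z => `[<A z>]) (fun z => `[<B z>]) <=
    3 * Num.sqrt (fine (mu A) - fine (mu B)).
Proof.
move=> mA mB BA.
pose a := fine (mu A); pose b := fine (mu B).
have mAf := fin_measurable_bool mA; have mBf := fin_measurable_bool mB.
have mD : measurable (A `\` B) by exact: measurableD.
have mC : measurable (~` A) by exact: measurableC.
have aE : a = b + fine (mu (A `\` B)).
  rewrite /a (law_sum mu1 mBf mA) big_bool/=; congr (fine (mu _) + fine (mu _)).
    apply/seteqP; split => [z [_ /= /asboolP//]|z Bz].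
    by split; [exact: BA|exact/asboolP].
  apply/seteqP; split => [z [Az /= /asboolPn]//|z [Az nBz]].
  by split => //; exact/asboolPn.
have cE : fine (mu (~` A)) = 1 - a.
  rewrite /a; have := law_sum mu1 mAf measurableT.
  rewrite mu1 big_bool/= !setTI.
  rewrite (_ : _ @^-1` [set true] = A); last first.
    by apply/seteqP; split => z /=; [move/asboolP|move=> ?; exact/asboolP].
  rewrite (_ : _ @^-1` [set false] = ~` A); last first.
    by apply/seteqP; split => z /=; [move/asboolPn|move=> ?; exact/asboolPn].
  by move=> ->; ring.
have -> : cent mu (fun z => `[<A z>]) (fun z => `[<B z>]) =
   (1 - a + (a - b)) * ln (1 - a + (a - b)) - (1 - a) * ln (1 - a)
     - (a - b) * ln (a - b).
  have sum2 (F : bool * bool -> R) : \sum_x F x =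
      F (true, true) + F (true, false) + (F (false, true) + F (false, false)).
    rewrite (eq_bigr (fun x => F (x.1, x.2))); last by case.
    by rewrite -(pair_bigA _ (fun x y => F (x, y)))/= !big_bool.
  have setB1 : (fun z => `[<B z>]) @^-1` [set true] = B.
    by apply/seteqP; split => z /=; [move/asboolP|move=> ?; exact/asboolP].
  have setB0 : (fun z => `[<B z>]) @^-1` [set false] = ~` B.
    by apply/seteqP; split => z /=; [move/asboolPn|move=> ?; exact/asboolPn].
  have bE : law mu (fun z => `[<B z>]) true = b by rewrite /law setB1.
  have b'E : law mu (fun z => `[<B z>]) false = 1 - b.
    by have := sum_law mu1 mBf; rewrite big_bool/= bE => <-; ring.
  pose p := law mu (fun z => (`[<A z>], `[<B z>])).
  have p11 : p (true, true) = b.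
    rewrite /p /law; congr (fine (mu _)); apply/seteqP; split.
      by move=> z [_ /asboolP].
    by move=> z Bz /=; congr pair; apply/asboolP => //; exact: BA.
  have p10 : p (true, false) = a - b.
    rewrite aE addrAC subrr add0r /p /law; congr (fine (mu _)); apply/seteqP; split.
      by move=> z [/asboolP ? /asboolPn ?].
    by move=> z [Az Bz] /=; congr pair; [exact/asboolP|exact/asboolPn].
  have p01 : p (false, true) = 0.
    rewrite /p /law (_ : _ @^-1` _ = set0) ?measure0//.
    by apply/seteqP; split => // z [/asboolPn nA /asboolP /BA].
  have p00 : p (false, false) = 1 - a.
    rewrite -cE /p /law; congr (fine (mu _)); apply/seteqP; split.
      by move=> z [/asboolPn ? _].
    move=> z nA /=; congr pair; apply/asboolPn => // Bz; apply: nA; exact: BA.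
  rewrite /cent !entE sum2 big_bool/= -/p p11 p10 p01 p00 bE b'E mul0r.
  have -> : 1 - a + (a - b) = 1 - b by ring.
  ring.
apply: entropy_increment_le.
- by rewrite -cE fine_ge0.
- by rewrite aE addrAC subrr add0r fine_ge0.
- have : 0 <= b by rewrite fine_ge0.
  by rewrite /b; lra.
Qed.

Variables (I : nat -> finType) (W : forall j, T -> I j).
Hypothesis mW : forall j, fin_measurable (W j).
Hypothesis W_refine : forall i j, (i <= j)%N ->
  forall z z', W j z = W j z' -> W i z = W i z'.

(* The sets that are asymptotically determined by the partitions W j. *)
Definition approximable : set (set T) := [set A | measurable A /\
  forall e : R, 0 < e -> exists j, cent mu (fun z => `[<A z>]) (W j) <= e].

Lemma approximable_setC A : approximable A -> approximable (~` A).
Proof.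
move=> [mA hA]; split => [|e /hA[j hj]]; first exact: measurableC.
exists j; apply: le_trans hj; apply: (cent_determined_le mu1) => //.
  exact: fin_measurable_bool.
by move=> z z' /(congr1 negb); rewrite -!asbool_neg.
Qed.

Lemma approximable_setU A B : approximable A -> approximable B ->
  approximable (A `|` B).
Proof.
move=> [mA hA] [mB hB]; split => [|e e0]; first exact: measurableU.
have [i hi] := hA (e / 2) (divr_gt0 e0 (ltr0Sn R 1)).
have [j hj] := hB (e / 2) (divr_gt0 e0 (ltr0Sn R 1)).
exists (maxn i j).
have mAf := fin_measurable_bool mA; have mBf := fin_measurable_bool mB.
have h1 := cent_le_cond mu1 mAf (@mW (maxn i j)) (@mW i) (W_refine (leq_maxl i j)).
have h2 := cent_le_cond mu1 mBf (@mW (maxn i j)) (@mW j) (W_refine (leq_maxr i j)).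
have h3 := cent_pair_le mu1 mAf mBf (@mW (maxn i j)).
rewrite [e]splitr; apply: le_trans (lerD hi hj).
apply: le_trans (lerD h1 h2); apply: le_trans h3.
apply: (cent_determined_le mu1) => //; first exact: fin_measurable_pair.
move=> z z' [hz1 hz2]; rewrite !asbool_or; congr (_ || _) => //.
Qed.

Lemma approximable_bigcup (F : (set T)^nat) : (forall n, approximable (F n)) ->
  approximable (\bigcup_n F n).
Proof.
move=> hF; have mF : measurable (\bigcup_n F n).
  by apply: bigcupT_measurable => n; have [] := hF n.
split => // e e0.
pose G n := \big[setU/set0]_(i < n) F i.
have hG n : approximable (G n.+1).
  elim: n => [|n ih]; first by rewrite /G big_ord1; exact: hF.
  by rewrite /G big_ord_recr/=; exact: approximable_setU.
have GF n : G n `<=` \bigcup_n F n.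
  by rewrite /G -bigcup_mkord => z [i _ ?]; exists i.
pose a := fine (mu (\bigcup_n F n)).
have cvG : (fun n => fine (mu (G n.+1))) @ \oo --> a.
  have : mu \o (fun n => G n.+1) @ \oo --> mu (\bigcup_n F n).
    rewrite (_ : \bigcup_n F n = \bigcup_n G n.+1); last first.
      apply/seteqP; split => z [n _ h].
        by exists n => //; rewrite /G big_ord_recr/=; right.
      exact: GF h.
    apply: nondecreasing_cvg_mu.
    - by move=> n; have [] := hG n.
    - by apply: bigcupT_measurable => n; have [] := hG n.
    - by apply/nondecreasing_seqP => n; rewrite subsetEset/G [X in _ `<=` X]big_ord_recr/=; left.
  rewrite -[X in _ --> X]fineK ?(measure1_fin mu1)//.
  by move/fine_cvgP => [].
(* Three times the square root of this mass is [e / 2]. *)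
have d0 : 0 < (e / 6) ^+ 2 by rewrite exprn_gt0// divr_gt0.
move/cvgrPdist_lt : cvG => /(_ _ d0)[N _ /(_ N (leqnn N)) /= hN].
have [mGN /(_ (e / 2) (divr_gt0 e0 (ltr0Sn R 1)))[j hj]] := hG N.
exists j.
have mGf := fin_measurable_bool mGN; have mFf := fin_measurable_bool mF.
apply: le_trans (cent_trans mu1 mFf mGf (@mW j)) _.
rewrite [e]splitr lerD//.
apply: le_trans (cent_subset_le mF mGN (GF _)) _.
have -> : e / 2 = 3 * (e / 6) by field.
rewrite ler_pM2l// -(@ger0_norm _ (e / 6)) ?divr_ge0 ?(ltW e0)// -sqrtr_sqr.
by rewrite ler_sqrt ?(ltW d0)//; apply: ltW; apply: le_lt_trans hN; rewrite ler_norm.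
Qed.

(** This replaces martingale convergence: the level sets of each [W j] being approximable, so is
    everything they generate. *)
Lemma approximable_sigma_algebra : sigma_algebra setT approximable.
Proof.
split.
- split => [|e e0]; first exact: measurable0.
  exists 0%N; apply: (le_trans (cent_determined_le0 mu1 _ _)) => //; last exact: ltW.
- by move=> A hA; rewrite setTD; exact: approximable_setC.
- exact: approximable_bigcup.
Qed.

Lemma cent_approximation (J : finType) (f : T -> J) :
  fin_measurable f -> (forall i, approximable (f @^-1` [set i])) ->
  forall e, 0 < e -> exists j, cent mu f (W j) <= e.
Proof.
move=> mf hf e e0.
(* The successor makes the divisor positive without a case distinction on [J]. *)
pose c := #|J|.+1%:R : R.
have c0 : 0 < c by rewrite ltr0n.
have /choice[k hk] : forall i : J, exists j, cent mu (fun z => f z == i) (W j) <= e / c.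
  move=> i; have [_ /(_ (e / c) (divr_gt0 e0 c0))[j hj]] := hf i; exists j.
  apply: le_trans hj; apply: (cent_determined_le mu1) => //.
    exact: fin_measurable_bool.
  move=> z z'; rewrite (_ : `[< _ >] = (f z == i)); last by apply/asboolP/eqP.
  by rewrite (_ : `[< _ >] = (f z' == i)) => //; apply/asboolP/eqP.
exists (\max_i k i); apply: (le_trans (cent_indicator_le mu1 _ _)) => //.
apply: (@le_trans _ _ (\sum_(i : J) e / c)).
  apply: ler_sum => i _; apply: le_trans (hk i).
  apply: (cent_le_cond mu1) => //; first exact: (fin_measurable_comp (fun j => j == i) mf).
  by apply: W_refine; exact: leq_bigmax.
rewrite sumr_const -mulr_natl mulrCA ler_piMr ?(ltW e0)//.
by rewrite ler_pdivrMr// mul1r ler_nat.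
Qed.

End Approximation.

(** * Entropy of a disintegration *)

Section Expectation.
Context d (Y : measurableType d) (R : realType) (nu : {measure set Y -> \bar R}).
Hypothesis nu1 : nu [set: Y] = 1%E.
Implicit Types u v : Y -> R.

(** Laws and entropies of finite partitions are bounded in [y]; on this class the integral against
    [nu] is a real number and is linear. *)
Definition bounded_measurable u :=
  measurable_fun [set: Y] u /\ exists M, forall y, `|u y| <= M.

Notation "'E[ u ]" := (\int[nu]_(y in [set: Y]) u y) (at level 0).

Lemma bounded_measurable_integrable u :
  bounded_measurable u -> nu.-integrable [set: Y] (EFin \o u).
Proof.
move=> [mu [M uM]]; apply: measurable_bounded_integrable => //.
  by rewrite nu1 ltry.
by exists M; split; [exact: num_real|move=> x Mx y _; exact: le_trans (uM y) (ltW Mx)].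
Qed.

Lemma bounded_measurable_cst c : bounded_measurable (fun=> c).
Proof. by split => //; exists `|c|. Qed.

Lemma bounded_measurableD u v : bounded_measurable u -> bounded_measurable v ->
  bounded_measurable (fun y => u y + v y).
Proof.
move=> [mu [M uM]] [mv [N vN]]; split; first exact: measurable_funD.
by exists (M + N) => y; apply: le_trans (ler_normD _ _) _; exact: lerD.
Qed.

Lemma bounded_measurableM u v : bounded_measurable u -> bounded_measurable v ->
  bounded_measurable (fun y => u y * v y).
Proof.
move=> [mu [M uM]] [mv [N vN]]; split; first exact: measurable_funM.
by exists (M * N) => y; rewrite normrM ler_pM.
Qed.

Lemma bounded_measurableN u : bounded_measurable u -> bounded_measurable (fun y => - u y).
Proof.
move=> [mu [M uM]]; split; first exact: measurable_funN.
by exists M => y; rewrite normrN.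
Qed.

Lemma bounded_measurableB u v : bounded_measurable u -> bounded_measurable v ->
  bounded_measurable (fun y => u y - v y).
Proof. by move=> bu bv; apply: bounded_measurableD => //; exact: bounded_measurableN. Qed.

Lemma bounded_measurable_sum (I : finType) (u : I -> Y -> R) :
  (forall i, bounded_measurable (u i)) -> bounded_measurable (fun y => \sum_i u i y).
Proof.
move=> bu; split; first by apply: measurable_sum => i; have [] := bu i.
have /choice[M hM] : forall i, exists M, forall y, `|u i y| <= M by move=> i; have [] := bu i.
exists (\sum_i M i) => y; apply: le_trans (ler_norm_sum _ _ _) _.
by apply: ler_sum => i _; exact: hM.
Qed.

Lemma expectation_cst c : 'E[fun=> c] = c.
Proof. by rewrite Rintegral_cst// nu1 mulr1. Qed.

Lemma expectationD u v : bounded_measurable u -> bounded_measurable v ->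
  'E[fun y => u y + v y] = 'E[u] + 'E[v].
Proof. by move=> bu bv; rewrite RintegralD//; exact: bounded_measurable_integrable. Qed.

Lemma expectationB u v : bounded_measurable u -> bounded_measurable v ->
  'E[fun y => u y - v y] = 'E[u] - 'E[v].
Proof. by move=> bu bv; rewrite RintegralB//; exact: bounded_measurable_integrable. Qed.

Lemma expectationZ c u : bounded_measurable u -> 'E[fun y => c * u y] = c * 'E[u].
Proof. by move=> bu; rewrite RintegralZl//; exact: bounded_measurable_integrable. Qed.

Lemma expectation_sum (I : finType) (u : I -> Y -> R) :
  (forall i, bounded_measurable (u i)) -> 'E[fun y => \sum_i u i y] = \sum_i 'E[u i].
Proof.
move=> bu.
suff h s : bounded_measurable (fun y => \sum_(i <- s) u i y) /\
    'E[fun y => \sum_(i <- s) u i y] = \sum_(i <- s) 'E[u i].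
  by have [_] := h (index_enum I).
elim: s => [|i s [bs ih]].
  under eq_fun do rewrite big_nil.
  by split; [exact: bounded_measurable_cst|rewrite big_nil expectation_cst].
under eq_fun do rewrite big_cons.
split; first exact: bounded_measurableD.
by rewrite big_cons expectationD// ih.
Qed.

Lemma expectation_eq_ae u v : bounded_measurable u -> bounded_measurable v ->
  {ae nu, forall y, u y = v y} -> 'E[u] = 'E[v].
Proof.
move=> [mu _] [mv _] uv; congr fine; apply: ae_eq_integral => //.
- exact/measurable_EFinP.
- exact/measurable_EFinP.
- by apply: filterS uv => y uv _; rewrite uv.
Qed.

Lemma expectation_le_ae u v : bounded_measurable u -> bounded_measurable v ->
  {ae nu, forall y, u y <= v y} -> 'E[u] <= 'E[v].
Proof.
move=> bu bv uv.
(* Monotonicity of the integral is applied to functions ordered everywhere, so [v] is replaced by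
   the maximum, which equals it a.e. *)
have bm : bounded_measurable (fun y => Num.max (u y) (v y)).
  case: bu bv => [mu [M uM]] [mv [N vN]]; split; first exact: measurable_maxr.
  exists (M + N) => y.
  have M0 : 0 <= M by exact: le_trans (uM y).
  have N0 : 0 <= N by exact: le_trans (vN y).
  case: (leP (u y) (v y)) => _.
    by apply: le_trans (vN y) _; rewrite lerDr.
  by apply: le_trans (uM y) _; rewrite lerDl.
rewrite [leRHS](@expectation_eq_ae _ (fun y => Num.max (u y) (v y)))//.
  apply: le_Rintegral => //; try exact: bounded_measurable_integrable.
  by move=> y _; rewrite le_max lexx.
by apply: filterS uv => y uv; apply/esym/max_idPr.
Qed.

Lemma expectation_eq0_ae u : bounded_measurable u -> (forall y, 0 <= u y) ->
  'E[u] <= 0 -> {ae nu, forall y, u y = 0}.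
Proof.
move=> bu u0 Eu.
have [iu _] := bu.
have /ae_eq_integral_abs h : measurable_fun [set: Y] (EFin \o u) by exact/measurable_EFinP.
have : (\int[nu]_(y in [set: Y]) `|(EFin \o u) y| = 0)%E.
  rewrite (eq_integral (EFin \o u)); last by move=> y _ /=; rewrite ger0_norm.
  rewrite -[LHS]fineK; last exact/integrable_fin_num/bounded_measurable_integrable.
  congr EFin; apply/eqP; rewrite eq_le Eu/=.
  by apply: fine_ge0; apply: integral_ge0 => y _; rewrite lee_fin.
move=> /(h nu measurableT) {}h; apply: filterS h => y /(_ I) /= [].
by [].
Qed.

End Expectation.

Section Cross_entropy.
Context d (T : measurableType d) (R : realType) (P : {measure set T -> \bar R}).
Hypothesis P1 : P [set: T] = 1%E.

(** Coding bound: for each value of [g], [w] gives subnormalised code weights for [f], and the mean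
    code length [- ln w] is at least the conditional entropy. It is Gibbs' inequality against
    [law P g x.2 * w x]. *)
Lemma cent_cross_le (I J : finType) (f : T -> I) (g : T -> J) (w : I * J -> R) :
  fin_measurable f -> fin_measurable g ->
  (forall x, 0 <= w x) ->
  (forall j, law P g j != 0 -> \sum_i w (i, j) <= 1) ->
  (forall x, w x = 0 -> law P (fun z => (f z, g z)) x = 0) ->
  cent P f g <= - \sum_x law P (fun z => (f z, g z)) x * ln (w x).
Proof.
move=> mf mg w0 w1 wz; pose m := law P (fun z => (f z, g z)).
have mfg := fin_measurable_pair mf mg.
have m_ge0 x : 0 <= m x by exact: law_ge0.
have g_ge0 j : 0 <= law P g j by exact: law_ge0.
have m_gt0 i j : 0 < m (i, j) -> 0 < law P g j.
  move=> h; rewrite (law_pairr P1 j mf mg) (bigD1 i)//= ltr_pwDl//.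
  by rewrite sumr_ge0.
have sum_pair (F : I * J -> R) : \sum_x F x = \sum_j \sum_i F (i, j).
  by rewrite exchange_big pair_bigA; apply: eq_bigr => -[].
have gibbs_w : \sum_x m x * ln (law P g x.2 * w x) <= \sum_x m x * ln (m x).
  apply: gibbs => //.
  - by move=> x; rewrite mulr_ge0.
  - case=> i j /eqP; rewrite mulf_eq0 => /orP[/eqP/= g0|/eqP /wz//].
    apply/eqP; rewrite eq_le m_ge0 andbT leNgt; apply/negP => /m_gt0.
    by rewrite g0 ltxx.
  - rewrite !sum_pair; apply: ler_sum => j _ /=.
    rewrite -mulr_sumr -(law_pairr P1 j mf mg).
    have [->|gj] := eqVneq (law P g j) 0; first by rewrite mul0r.
    by rewrite ler_piMr// w1.
have : \sum_x m x * ln (law P g x.2 * w x) =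
    - ent P g + \sum_x m x * ln (w x).
  transitivity (\sum_x (m x * ln (law P g x.2) + m x * ln (w x))).
    apply: eq_bigr => -[i j] _; rewrite -mulrDr.
    have := m_ge0 (i, j); rewrite le_eqVlt => /predU1P[<-|h]; first by rewrite !mul0r.
    rewrite lnM// ?posrE ?(m_gt0 _ _ h)//.
    rewrite lt_neqAle w0 andbT; apply/eqP => /esym /wz e.
    by move: h; rewrite /m e ltxx.
  rewrite big_split/= entE opprK; congr (_ + _); rewrite sum_pair.
  by apply: eq_bigr => j _; rewrite /= -mulr_suml -(law_pairr P1 j mf mg).
rewrite /cent [ent P (fun z => (f z, g z))]entE -/m.
by move: gibbs_w; lra.
Qed.

Lemma cent_crossE (I J : finType) (f : T -> I) (g : T -> J) :
  fin_measurable f -> fin_measurable g ->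
  cent P f g = - \sum_x law P (fun z => (f z, g z)) x *
    ln (law P (fun z => (f z, g z)) x / law P g x.2).
Proof.
move=> mf mg; pose m := law P (fun z => (f z, g z)).
have m_ge0 x : 0 <= m x by exact: law_ge0.
have sum_pair (F : I * J -> R) : \sum_x F x = \sum_j \sum_i F (i, j).
  by rewrite exchange_big pair_bigA; apply: eq_bigr => -[].
rewrite (eq_bigr (fun x => m x * ln (m x) - m x * ln (law P g x.2))); last first.
  case=> i j _; rewrite -mulrBr.
  have := m_ge0 (i, j); rewrite le_eqVlt => /predU1P[e|h].
    by rewrite -/m -e !mul0r.
  rewrite ln_div// posrE (law_pairr P1 j mf mg) (bigD1 i)//= ltr_pwDl//.
  by rewrite sumr_ge0.
rewrite sumrB opprB addrC /cent !entE opprK; congr (_ + _); rewrite sum_pair.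
by apply: eq_bigr => j _; rewrite /= -mulr_suml -(law_pairr P1 j mf mg).
Qed.

Lemma ent_constant (J : finType) (g : T -> J) j : fin_measurable g ->
  P (g @^-1` [set j]) = 1%E -> ent P g = 0.
Proof.
move=> mg gj; have lj : law P g j = 1 by rewrite /law gj.
have l0 i : i != j -> law P g i = 0.
  move=> ij; have := sum_law P1 mg.
  rewrite (bigD1 j)//= lj => /(canRL (addKr _)); rewrite addNr => /eqP.
  rewrite psumr_eq0; last by move=> ? _; exact: law_ge0.
  by move=> /allP/(_ i (mem_index_enum _)); rewrite ij => /eqP.
rewrite entE (bigD1 j)//= lj ln1 mulr0 add0r big1 ?oppr0// => i ij.
by rewrite l0// mul0r.
Qed.

Lemma ent_ge0 (J : finType) (g : T -> J) : fin_measurable g -> 0 <= ent P g.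
Proof.
move=> mg; rewrite entE oppr_ge0 sumr_le0// => i _.
by rewrite mulr_ge0_le0 ?law_ge0// ln_le0// law_le1.
Qed.

Lemma ent_pair_constant (I J : finType) (f : T -> I) (g : T -> J) j :
  fin_measurable f -> fin_measurable g ->
  P (g @^-1` [set j]) = 1%E -> ent P (fun z => (f z, g z)) = ent P f.
Proof.
move=> mf mg gj; have e0 := ent_constant mg gj.
have c1 := cent_ge0 P1 mf mg; have c2 := cent_le_ent P1 mf mg.
have : ent P (fun z => (g z, f z)) = ent P (fun z => (f z, g z)).
  apply: ent_determined => //; try exact: fin_measurable_pair.
  by move=> z z'; split => [[-> ->]|[-> ->]].
have := cent_le_ent P1 mg mf; have := cent_ge0 P1 mg mf.
by move: c1 c2; rewrite /cent e0; lra.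
Qed.

End Cross_entropy.

Section Disintegration.
Context dZ dY (Z : measurableType dZ) (Y : measurableType dY) (R : realType).
Variables (mu : {measure set Z -> \bar R}) (nu : {measure set Y -> \bar R}).
Hypotheses (mu1 : mu [set: Z] = 1%E) (nu1 : nu [set: Y] = 1%E).
Variables (q : Z -> Y) (k : R.-pker Y ~> Z).
Hypothesis mq : measurable_fun [set: Z] q.
Hypothesis m1Y : forall y : Y, measurable [set y].
Hypothesis muE : forall B, measurable B -> mu B = (\int[nu]_y k y B)%E.
Hypothesis k_fiber : {ae nu, forall y, k y (q @^-1` [set y]) = 1%E}.

Let k1 y : k y [set: Z] = 1%E. Proof. exact: prob_kernel. Qed.

Lemma bounded_measurable_law (I : finType) (f : Z -> I) i : fin_measurable f ->
  bounded_measurable (fun y => law (k y) f i).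
Proof.
move=> mf; split.
  by apply: measurableT_comp => //; exact: measurable_kernel.
by exists 1 => y; rewrite ger0_norm ?law_ge0// law_le1.
Qed.

Lemma bounded_measurable_ent (I : finType) (f : Z -> I) : fin_measurable f ->
  bounded_measurable (fun y => ent (k y) f).
Proof.
move=> mf; under eq_fun do rewrite entE.
apply: bounded_measurableN; apply: bounded_measurable_sum => i; split.
  have [ml _] := bounded_measurable_law i mf.
  by apply: measurable_funM => //; apply: measurableT_comp => //; exact: measurable_ln.
exists 1 => y.
have l0 := law_ge0 (k y) f i; have l1 := law_le1 (k1 y) i mf.
rewrite ler0_norm; last by rewrite mulr_ge0_le0// ln_le0.
have := mulr_ln_le l0 ler01; rewrite ln1 mulr0 => /(_ _)/wrap[|].
  by move=> /eqP; rewrite oner_eq0.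
by lra.
Qed.

Lemma expectation_law (I : finType) (f : Z -> I) i : fin_measurable f ->
  \int[nu]_(y in [set: Y]) law (k y) f i = law mu f i.
Proof.
move=> mf; rewrite /law muE//; congr fine; apply: eq_integral => y _.
by rewrite fineK// (measure1_fin (k1 y)).
Qed.

(** A nonnegative function with zero integral vanishes a.e. This supplies the absolute continuity
    that Gibbs' inequality requires under [k y]. *)
Lemma law_kernel_eq0 (I : finType) (f : Z -> I) : fin_measurable f ->
  {ae nu, forall y, forall i, law mu f i = 0 -> law (k y) f i = 0}.
Proof.
move=> mf; apply: filter_forall => i.
have [li|li] := eqVneq (law mu f i) 0; last by apply: aeW => y e; rewrite e eqxx in li.
have h : {ae nu, forall y, law (k y) f i = 0}.
  apply: (expectation_eq0_ae nu1); first exact: bounded_measurable_law.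
    by move=> y; exact: law_ge0.
  by rewrite expectation_law// li.
by apply: filterS h => y ->.
Qed.

(** Concavity by coding: the conditional weights of [mu] are admissible code weights under almost
    every [k y], and the mean code length, averaged over [y], is [cent mu f g]. *)
Lemma expectation_cent_le (I J : finType) (f : Z -> I) (g : Z -> J) :
  fin_measurable f -> fin_measurable g ->
  \int[nu]_(y in [set: Y]) cent (k y) f g <= cent mu f g.
Proof.
move=> mf mg; have mfg := fin_measurable_pair mf mg.
pose w (x : I * J) := law mu (fun z => (f z, g z)) x / law mu g x.2.
rewrite [leRHS](cent_crossE mu1 mf mg).
have bl x := bounded_measurable_law x mfg.
have -> : \sum_x law mu (fun z => (f z, g z)) x * ln (w x) =
    \int[nu]_(y in [set: Y]) \sum_x ln (w x) * law (k y) (fun z => (f z, g z)) x.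
  rewrite expectation_sum//; last first.
    by move=> x; apply: bounded_measurableM => //; exact: bounded_measurable_cst.
  by apply: eq_bigr => x _; rewrite expectationZ// -(expectation_law x mfg) mulrC.
have bs : bounded_measurable (fun y => \sum_x ln (w x) * law (k y) (fun z => (f z, g z)) x).
  apply: bounded_measurable_sum => x; apply: bounded_measurableM => //.
  exact: bounded_measurable_cst.
rewrite -mulN1r -expectationZ//.
apply: expectation_le_ae => //.
- by apply: bounded_measurableB; exact: bounded_measurable_ent.
- by apply: bounded_measurableM => //; exact: bounded_measurable_cst.
apply: filterS2 (law_kernel_eq0 mfg) (law_kernel_eq0 mg) => y hfg hg.
rewrite mulN1r; under eq_bigr do rewrite mulrC.
apply: (cent_cross_le (k1 y)) => //.
- by move=> x; rewrite divr_ge0// law_ge0.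
- move=> j gj; rewrite /w/= -mulr_suml -(law_pairr mu1 j mf mg) divff//.
  by apply: contra_neq gj; exact: hg.
- move=> [i j] /eqP; rewrite mulf_eq0 invr_eq0 => /orP[/eqP/hfg//|/eqP/= g0].
  apply: hfg; apply/eqP; rewrite eq_le law_ge0 andbT -g0 (law_pairr mu1 j mf mg).
  by rewrite (bigD1 i)//= lerDl sumr_ge0// => ? _; exact: law_ge0.
Qed.

(** On the fiber that carries [k y] the map [q] is constant, so a condition on [q] either holds
    almost surely or fails almost surely. *)
Lemma kernel_fiber y A B : k y (q @^-1` [set y]) = 1%E ->
  measurable A -> measurable B ->
  k y (A `&` q @^-1` B) = if y \in B then k y A else 0%E.
Proof.
move=> ky mA mB.
have mqB C : measurable C -> measurable (q @^-1` C).
  by move=> mC; rewrite -[X in measurable X]setTI; exact: mq.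
have null C : measurable C -> C `<=` ~` (q @^-1` [set y]) -> k y C = 0%E.
  move=> mC Cy; apply/eqP; rewrite eq_le measure_ge0 andbT.
  have : k y (~` (q @^-1` [set y])) = 0%E.
    rewrite -setTD measureD//; [|exact: mqB|].
      by rewrite setTI; transitivity (1 - 1 : \bar R)%E;
        [congr (_ - _)%E; [exact: k1|exact: ky]|rewrite subee].
    by rewrite (_ : _ [set: Z] = 1%E) ?ltry//; exact: k1.
  move=> <-; apply: le_measure => //; rewrite inE//.
  by apply: measurableC; exact: mqB.
case: ifPn => [/set_mem By|/negP yB]; last first.
  apply: null; first by apply: measurableI => //; exact: mqB.
  by move=> z [_ /= Bqz] /= e; apply: yB; rewrite -e; exact/mem_set.
rewrite [RHS](measureDI _ _ (mqB _ mB))// [X in (X + _)%E]null ?add0e//.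
  by apply: measurableD => //; exact: mqB.
by move=> z [_ nB] /= e; apply: nB; rewrite /= e.
Qed.

Lemma ent_kernel_fiber (I J : finType) (f : Z -> I) (G : Y -> J) :
  fin_measurable f -> fin_measurable G ->
  {ae nu, forall y, ent (k y) (fun z => (f z, G (q z))) = ent (k y) f}.
Proof.
move=> mf mG.
have mGq : fin_measurable (fun z => G (q z)).
  move=> j; rewrite -[X in measurable X]setTI.
  by have := mq measurableT (mG j).
apply: filterS k_fiber => y ky; apply: (ent_pair_constant (k1 y) (j := G y)) => //.
have := kernel_fiber ky measurableT (mG (G y)).
by rewrite setTI k1 mem_set.
Qed.

(** Under [k y] the function [G \o q] is almost surely constant, so conditioning on it changes
    nothing; the rest is concavity. The converse, up to [e] and for a suitable [G], is
    [cent_fiber_approximation]. *)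
Lemma expectation_ent_fiber_le (I K : finType) (f : Z -> I) (G : Y -> K) :
  fin_measurable f -> fin_measurable G ->
  \int[nu]_(y in [set: Y]) ent (k y) f <= cent mu f (fun z => G (q z)).
Proof.
move=> mf mG.
have mGq : fin_measurable (fun z => G (q z)).
  move=> j; rewrite -[X in measurable X]setTI.
  by have := mq measurableT (mG j).
apply: le_trans (expectation_cent_le mf mGq).
apply: expectation_le_ae => //.
- exact: bounded_measurable_ent.
- by apply: bounded_measurableB; apply: bounded_measurable_ent => //; exact: fin_measurable_pair.
have mt : fin_measurable (fun _ : Z => tt) by exact: fin_measurable_cst.
apply: filterS2 (ent_kernel_fiber mf mG) (ent_kernel_fiber mt mG) => y h1 h2.
rewrite /cent h1; have <- : ent (k y) (fun z => (tt, G (q z))) = ent (k y) (fun z => G (q z)).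
  apply: (ent_determined (k1 y)) => //; first exact: fin_measurable_pair.
  by move=> z z'; split => [->|[]].
rewrite h2 (ent_constant (k1 y) (j := tt))// ?subr0//.
by rewrite (_ : _ @^-1` _ = setT)//; exact/seteqP.
Qed.

End Disintegration.

Section Fiber_approximation.
Context dZ dY (Z : measurableType dZ) (Y : measurableType dY) (R : realType).
Variables (mu : {measure set Z -> \bar R}) (nu : {measure set Y -> \bar R}).
Hypotheses (mu1 : mu [set: Z] = 1%E) (nu1 : nu [set: Y] = 1%E).
Variables (q : Z -> Y) (k : R.-pker Y ~> Z).
Hypothesis mq : measurable_fun [set: Z] q.
Hypothesis m1Y : forall y : Y, measurable [set y].
Hypothesis muE : forall B, measurable B -> mu B = (\int[nu]_y k y B)%E.
Hypothesis k_fiber : {ae nu, forall y, k y (q @^-1` [set y]) = 1%E}.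

Let k1 y : k y [set: Z] = 1%E. Proof. exact: prob_kernel. Qed.

Lemma fin_measurable_fiber (J : finType) (G : Y -> J) :
  fin_measurable G -> fin_measurable (fun z => G (q z)).
Proof.
move=> mG j; rewrite -[X in measurable X]setTI.
by have := mq measurableT (mG j).
Qed.

Lemma law_kernel_fiber (I J : finType) (f : Z -> I) (G : Y -> J) y i j :
  fin_measurable f -> fin_measurable G -> k y (q @^-1` [set y]) = 1%E ->
  law (k y) (fun z => (f z, G (q z))) (i, j) = if G y == j then law (k y) f i else 0.
Proof.
move=> mf mG ky; rewrite /law.
rewrite (_ : _ @^-1` _ = f @^-1` [set i] `&` q @^-1` (G @^-1` [set j])); last first.
  by apply/seteqP; split => z /= [-> ->].
rewrite kernel_fiber//; case: eqP => Gy; first by rewrite mem_set.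
by rewrite memNset.
Qed.

Lemma fin_measurable_truncn (u : Y -> R) N : measurable_fun [set: Y] u ->
  (forall y, 0 <= u y <= 1) ->
  fin_measurable (fun y => inord (Num.truncn (N%:R * u y)) : 'I_N.+1).
Proof.
move=> mu_ u01 j.
rewrite (_ : _ @^-1` _ =
    [set: Y] `&` (fun y => N%:R * u y) @^-1` [set` `[(j%:R : R), j.+1%:R[]).
  by apply: measurable_funM => //; exact: measurable_itv.
apply/seteqP; split => y /=.
  move=> <-; split => //; have /andP[u0 u1] := u01 y.
  have Nu0 : 0 <= N%:R * u y by rewrite mulr_ge0.
  (* The value [N], attained when [u y = 1], is the reason for the type ['I_N.+1]; [inord] never
     falls back to its default. *)
  rewrite in_itv/= inordK ?truncn_itv// ltnS -(ler_nat R).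
  by apply: le_trans (_ : N%:R * u y <= _); rewrite ?truncn_le// ler_piMr.
by move=> [_]; rewrite in_itv/= => /truncn_def ->; rewrite inord_val.
Qed.

(* The cells of G pin the conditional law of f down to 1 / N, so f can be encoded
   at the cost of its conditional entropy with code weights constant on them. *)
Lemma cent_fiber_approximation (I : finType) (f : Z -> I) (e : R) :
  fin_measurable f -> 0 < e ->
  exists (J : finType) (G : Y -> J), fin_measurable G /\
    cent mu f (fun z => G (q z)) <= \int[nu]_(y in [set: Y]) ent (k y) f + e.
Proof.
move=> mf e0.
(* Rounding to multiples of [1 / N] will cost [ln (1 + #|I| / N) <= #|I| / N]. *)
have [N N0 Ne] : exists2 N : nat, (0 < N)%N & #|I|%:R / N%:R <= e.
  exists (Num.truncn (#|I|%:R / e)).+1 => //.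
  by rewrite ler_pdivrMr ?ltr0n// -ler_pdivrMl// mulrC ltW// truncnS_gt.
have NR0 : 0 < N%:R :> R by rewrite ltr0n.
pose x y i := law (k y) f i.
have x01 i y : 0 <= x y i <= 1 by rewrite law_ge0 law_le1.
pose G y := [ffun i => inord (Num.truncn (N%:R * x y i)) : 'I_N.+1].
have mG : fin_measurable G.
  apply: fin_measurable_ffun => i; apply: fin_measurable_truncn => //.
  by have [] := bounded_measurable_law k i mf.
have mGq := fin_measurable_fiber mG.
have G_itv y i : (G y i)%:R <= N%:R * x y i < (G y i).+1%:R.
  have /andP[u0 u1] := x01 i y.
  have Nu0 : 0 <= N%:R * x y i by rewrite mulr_ge0.
  rewrite ffunE inordK ?truncn_itv// ltnS -(ler_nat R).
  by apply: le_trans (_ : N%:R * x y i <= _); rewrite ?truncn_le// ler_piMr.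
(* The weights are proportional to the rounded values plus 1: the 1 keeps them positive and adds
   [#|I|] to a total of at most [N]. *)
pose M : R := N%:R + #|I|%:R.
have M0 : 0 < M by rewrite ltr_pwDl.
pose w (v : I * {ffun I -> 'I_N.+1}) : R := (v.2 v.1).+1%:R / M.
have w0 v : 0 < w v by rewrite divr_gt0.
exists {ffun I -> 'I_N.+1}, G; split => //.
have mfG := fin_measurable_pair mf mGq.
apply: (@le_trans _ _ (- \sum_v law mu (fun z => (f z, G (q z))) v * ln (w v))).
  apply: (cent_cross_le mu1) => //.
  - by move=> v; exact: ltW.
  (* Only values [j] attained by [G] count; for others the weights may add up to more than 1. *)
  - move=> j lj; have [z zj] : exists z, G (q z) = j.
      apply: contrapT => nz; move: lj; rewrite /law (_ : _ @^-1` _ = set0) ?measure0 ?eqxx//.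
      by apply/seteqP; split => // z zj; apply: nz; exists z.
    rewrite -mulr_suml ler_pdivrMr// mul1r -zj.
    rewrite (_ : M = \sum_i (N%:R * x (q z) i + 1)); last first.
      by rewrite big_split/= -mulr_sumr (sum_law (k1 _))// mulr1 sumr_const.
    by apply: ler_sum => i _; rewrite -natr1 lerD2r; have /andP[] := G_itv (q z) i.
  - by move=> v wv; have := w0 v; rewrite wv ltxx.
have bl v := bounded_measurable_law k v mfG.
have -> : \sum_v law mu (fun z => (f z, G (q z))) v * ln (w v) =
    \int[nu]_(y in [set: Y]) \sum_v ln (w v) * law (k y) (fun z => (f z, G (q z))) v.
  rewrite expectation_sum//; last first.
    by move=> v; apply: bounded_measurableM => //; exact: bounded_measurable_cst.
  by apply: eq_bigr => v _; rewrite expectationZ// -(expectation_law muE v mfG) mulrC.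
have bs : bounded_measurable
    (fun y => \sum_v ln (w v) * law (k y) (fun z => (f z, G (q z))) v).
  apply: bounded_measurable_sum => v; apply: bounded_measurableM => //.
  exact: bounded_measurable_cst.
rewrite -mulN1r -expectationZ// -[in leRHS](expectation_cst nu1 e).
have be := bounded_measurable_ent k mf; have bc := bounded_measurable_cst Y e.
rewrite -expectationD//.
apply: expectation_le_ae => //.
- by apply: bounded_measurableM => //; exact: bounded_measurable_cst.
- exact: bounded_measurableD.
apply: filterS k_fiber => y ky.
have -> : \sum_v ln (w v) * law (k y) (fun z => (f z, G (q z))) v =
    \sum_i ln (w (i, G y)) * x y i.
  rewrite (eq_bigr (fun v => ln (w (v.1, v.2)) * law (k y) (fun z => (f z, G (q z))) (v.1, v.2))); last by case.
  rewrite -(pair_bigA _ (fun i j => ln (w (i, j)) * law (k y) (fun z => (f z, G (q z))) (i, j)))/=.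
  apply: eq_bigr => i _; rewrite (bigD1 (G y))//= law_kernel_fiber// eqxx.
  rewrite big1 ?addr0// => j jG; rewrite law_kernel_fiber// eq_sym (negbTE jG).
  by rewrite mulr0.
rewrite mulN1r entE -/(x y).
suff : \sum_i x y i * ln (x y i) <= \sum_i ln (w (i, G y)) * x y i + e by lra.
apply: (@le_trans _ _ (\sum_i x y i * (ln (w (i, G y)) + e))); last first.
  under eq_bigr do rewrite mulrDr.
  rewrite big_split/= -mulr_suml (sum_law (k1 _))// mul1r lerD2r.
  by apply: ler_sum => i _; rewrite mulrC.
apply: ler_sum => i _; have /andP[] := x01 i y.
rewrite le_eqVlt => /predU1P[<- _|xi _]; first by rewrite !mul0r.
rewrite ler_pM2l//.
have Nx : N%:R * x y i / M <= w (i, G y).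
  by rewrite ler_pM2r ?invr_gt0// ltW//; have /andP[] := G_itv y i.
apply: (@le_trans _ _ (ln (N%:R * x y i / M) + e)); last first.
  by rewrite lerD2r ler_ln ?posrE// divr_gt0// mulr_gt0.
have -> : N%:R * x y i / M = x y i / (1 + #|I|%:R / N%:R).
  have h1 : N%:R != 0 :> R by rewrite gt_eqF.
  have h2 : N%:R + #|I|%:R != 0 :> R by rewrite gt_eqF// ltr_pwDl.
  by rewrite /M; field; rewrite h1 h2.
have c0 : 0 <= #|I|%:R / N%:R :> R by rewrite divr_ge0.
rewrite ln_div ?posrE// ?ltr_pwDl//.
have : ln (1 + #|I|%:R / N%:R) <= #|I|%:R / N%:R :> R.
  by apply: le_ln1Dx; apply: lt_le_trans c0; rewrite ltrN10.
by lra.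
Qed.

End Fiber_approximation.

(** * Itineraries *)

Section Growth_rate.
Variable R : realType.
Implicit Types u v : nat -> R.

Definition growth_rate u : \bar R := limn_esup (fun n => (n%:R^-1 * u n)%:E).

Lemma growth_rate_le u (M B : R) (n0 : nat) :
  (forall n, (n0 <= n)%N -> u n <= n%:R * M + B) -> (growth_rate u <= M%:E)%E.
Proof.
move=> uM; apply/lee_addgt0Pr => e e0.
pose N := maxn n0 (Num.truncn (`|B| / e)).+1.
apply: (@le_trans _ _ (ereal_sup ((fun n => (n%:R^-1 * u n)%:E) @` [set n | (N <= n)%N]))).
  by apply: ereal_inf_lbound; exists [set n | (N <= n)%N] => //; exists N.
apply: ge_ereal_sup => _ [n /= Nn <-]; rewrite -EFinD lee_fin.
have n0' : 0 < n%:R :> R by rewrite ltr0n; apply: leq_trans Nn; rewrite leq_max orbT.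
rewrite ler_pdivrMl//; apply: le_trans (uM n _) _.
  by apply: leq_trans Nn; rewrite leq_maxl.
rewrite mulrDr lerD2l; apply: le_trans (ler_norm B) _.
rewrite -ler_pdivrMr//; apply: ltW; apply: lt_le_trans (truncnS_gt _) _.
by rewrite ler_nat; apply: leq_trans Nn; rewrite leq_maxr.
Qed.

(** For an upper limit it suffices that the bound holds for arbitrarily large [n], for instance
    along multiples. *)
Lemma growth_rate_ge u (M : R) :
  (forall N, exists2 n, (N <= n)%N & (0 < n)%N && (n%:R * M <= u n)) ->
  (M%:E <= growth_rate u)%E.
Proof.
move=> uM; apply: le_ereal_inf_tmp => _ [V [N _ NV] <-].
have [n Nn /andP[n0 un]] := uM N.
apply: (@le_trans _ _ (n%:R^-1 * u n)%:E); last first.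
  by apply: ereal_sup_ubound; exists n => //; exact: NV.
by rewrite lee_fin ler_pdivlMl// ltr0n.
Qed.

Lemma le_growth_rate u v : (forall n, u n <= v n) -> (growth_rate u <= growth_rate v)%E.
Proof.
move=> uv; apply: le_ereal_inf_tmp => _ [V VF <-].
apply: (@le_trans _ _ (ereal_sup ((fun n => (n%:R^-1 * u n)%:E) @` V))).
  by apply: ereal_inf_lbound; exists V.
apply: ge_ereal_sup => _ [n Vn <-].
apply: (@le_trans _ _ (n%:R^-1 * v n)%:E); last by apply: ereal_sup_ubound; exists n.
by rewrite lee_fin ler_wpM2l.
Qed.

(** Half of Fekete's lemma: division with remainder bounds [u N] by the quotient times [u n], up to
    an error that does not depend on [N]. *)
Lemma growth_rate_subadditive u n : (forall m, 0 <= u m) ->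
  (forall m p, u (m + p)%N <= u m + u p) -> (0 < n)%N ->
  (growth_rate u <= (n%:R^-1 * u n)%:E)%E.
Proof.
move=> u0 usub n0.
have umul k : u (k * n)%N <= k%:R * u n + u 0.
  elim: k => [|k ih]; first by rewrite mul0n mul0r add0r.
  by rewrite mulSn -natr1; have := usub n (k * n)%N; lra.
apply: (@growth_rate_le _ _ (u 0 + \sum_(r < n) u r) 0) => N _.
rewrite {1}(divn_eq N n); apply: le_trans (usub _ _) _.
have h1 : u (N %% n)%N <= \sum_(r < n) u r.
  rewrite (bigD1 (Ordinal (ltn_pmod N n0)))//= lerDl.
  by apply: sumr_ge0 => i _; exact: u0.
have h2 : (N %/ n)%N%:R * u n <= N%:R * (n%:R^-1 * u n).
  rewrite mulrA ler_wpM2r// ler_pdivlMr ?ltr0n// -natrM ler_nat.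
  exact: leq_trunc_div.
by have := umul (N %/ n)%N; lra.
Qed.

End Growth_rate.

Section Itinerary.
Context d (Z : measurableType d) (R : realType) (mu : {measure set Z -> \bar R}).
Hypothesis mu1 : mu [set: Z] = 1%E.
Variable T : Z -> Z.
Hypothesis mT : measurable_fun [set: Z] T.
Hypothesis muT : invariant_measure mu T.

Definition itinerary (I : Type) (f : Z -> I) (n : nat) (z : Z) :=
  [ffun i : 'I_n => f (iter i T z)].

Lemma itinerary_eqP (I : Type) (f : Z -> I) n z z' :
  itinerary f n z = itinerary f n z' <->
  forall i, (i < n)%N -> f (iter i T z) = f (iter i T z').
Proof.
split=> [/ffunP h i ni|h]; first by have := h (Ordinal ni); rewrite !ffunE.
by apply/ffunP => i; rewrite !ffunE; exact: h.
Qed.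

Lemma itinerary_addP (I : Type) (f : Z -> I) n m z z' :
  itinerary f (n + m) z = itinerary f (n + m) z' <->
  itinerary f n z = itinerary f n z' /\
  itinerary f m (iter n T z) = itinerary f m (iter n T z').
Proof.
rewrite !itinerary_eqP; split=> [h|[h1 h2] i inm].
  split=> i ni; first by apply: h; rewrite ltn_addr.
  by rewrite -!iterD; apply: h; rewrite addnC ltn_add2l.
have [/h1//|ni] := ltnP i n.
have := h2 (i - n)%N; rewrite -!iterD subnK//; apply.
by rewrite ltn_subLR.
Qed.

Lemma measurable_iter n : measurable_fun [set: Z] (iter n T).
Proof.
elim: n => [|n ih]; first exact: measurable_id.
by rewrite (_ : iter n.+1 T = T \o iter n T)//; exact: measurableT_comp.
Qed.

Lemma fin_measurable_iter (I : finType) (f : Z -> I) n :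
  fin_measurable f -> fin_measurable (fun z => f (iter n T z)).
Proof.
move=> mf i; rewrite -[X in measurable X]setTI.
by have := measurable_iter n measurableT (mf i).
Qed.

Lemma fin_measurable_itinerary (I : finType) (f : Z -> I) n :
  fin_measurable f -> fin_measurable (itinerary f n).
Proof.
move=> mf; apply: fin_measurable_ffun => i; exact: fin_measurable_iter.
Qed.

Lemma ent_iter (I : finType) (f : Z -> I) n :
  fin_measurable f -> ent mu (fun z => f (iter n T z)) = ent mu f.
Proof.
move=> mf; rewrite !entE; congr (- _); apply: eq_bigr => i _.
suff -> : law mu (fun z => f (iter n T z)) i = law mu f i by [].
elim: n => [//|n <-]; rewrite /law.
have -> : (fun z => f (iter n.+1 T z)) @^-1` [set i] =
    T @^-1` ((fun z => f (iter n T z)) @^-1` [set i]).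
  by apply/seteqP; split => z /=; rewrite -iterSr.
by rewrite muT//; exact: fin_measurable_iter.
Qed.

Lemma cent_iter (I J : finType) (f : Z -> I) (g : Z -> J) n :
  fin_measurable f -> fin_measurable g ->
  cent mu (fun z => f (iter n T z)) (fun z => g (iter n T z)) = cent mu f g.
Proof.
move=> mf mg; rewrite /cent (ent_iter n mg).
by rewrite -(ent_iter n (fin_measurable_pair mf mg)).
Qed.

Lemma partition_entropy_itinerary (nu : {measure set Z -> \bar R}) (I : finType)
  (f : Z -> I) (P : I -> set Z) n : (forall i, P i = f @^-1` [set i]) ->
  partition_entropy nu (iterated_join T P (n := n)) = ent nu (itinerary f n).
Proof.
move=> PE; rewrite /ent; congr partition_entropy; apply/funext => w.
apply/seteqP; split => z /= h.
  apply/ffunP => i; rewrite ffunE.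
  by have := h i Logic.I; rewrite /= PE.
by move=> i _ /=; rewrite PE /= -h ffunE.
Qed.

Section Letter.
Variables (A : finType) (C : Z -> A).
Hypothesis mC : fin_measurable C.
(** [L j] stands for the last [j] letters before the present: seen from [iter j T z], they are the
    first [j] letters read from [z]. *)
Variable L : forall j, Z -> {ffun 'I_j -> A}.
Hypothesis mL : forall j, fin_measurable (@L j).
Hypothesis LT : forall j z, L j (iter j T z) = itinerary C j z.
Hypothesis L_refine : forall i j, (i <= j)%N ->
  forall z z', L j z = L j z' -> L i z = L i z'.

Let word := itinerary C.
Let mword n : fin_measurable (word n). Proof. exact: fin_measurable_itinerary. Qed.

(** By stationarity the past of length [j] may be placed at the start of the word; then the chain
    rule applies. *)
Lemma cent_itinerary_past n j :
  cent mu (word n) (@L j) = ent mu (word (j + n)) - ent mu (word j).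
Proof.
rewrite -(cent_iter j (@mword n) (@mL j)) /cent.
have mn := fin_measurable_iter j (@mword n).
have mj := fin_measurable_iter j (@mL j).
rewrite (ent_determined mu1 (f := fun z => L j (iter j T z)) (g := word j))//; last first.
  by move=> z z'; rewrite !LT.
rewrite (ent_determined mu1 (g := word (j + n)))//; first exact: fin_measurable_pair.
by move=> z z'; rewrite /word itinerary_addP !LT; split=> [[-> ->]|[-> ->]].
Qed.

Let increment j := ent mu (word j.+1) - ent mu (word j).

Let incrementE j : increment j = cent mu (word 1) (@L j).
Proof. by rewrite cent_itinerary_past addn1. Qed.

Let increment_noninc i j : (i <= j)%N -> increment j <= increment i.
Proof.
move=> ij; rewrite !incrementE; apply: (cent_le_cond mu1) => //.
exact: L_refine.
Qed.

Let increment_ge0 j : 0 <= increment j.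
Proof. by rewrite incrementE; exact: cent_ge0. Qed.

(** The increments are entropies of one letter given longer and longer pasts, hence nonincreasing;
    their infimum is their limit, the entropy per letter. *)
Definition entropy_rate : R := inf (range (fun j => ent mu (word j.+1) - ent mu (word j))).

Lemma entropy_rate_le j n :
  n%:R * entropy_rate <= ent mu (word (j + n)) - ent mu (word j).
Proof.
elim: n => [|n ih]; first by rewrite addn0 subrr mul0r.
rewrite -natr1 addnS mulrDl mul1r.
have : entropy_rate <= increment (j + n).
  by apply: ge_inf; [exists 0 => _ [i _ <-]; exact: increment_ge0|exists (j + n)%N].
by move: ih; rewrite /increment; lra.
Qed.

Lemma entropy_rate_approx (e : R) : 0 < e -> exists j, forall n,
  ent mu (word (j + n)) <= ent mu (word j) + n%:R * (entropy_rate + e).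
Proof.
move=> e0; have [_ [j _ <-] je] : exists2 x, range increment x & x < entropy_rate + e.
  apply: inf_adherent => //; split; first by exists (increment 0), 0%N.
  by exists 0 => _ [i _ <-]; exact: increment_ge0.
exists j; elim=> [|n ih]; first by rewrite addn0 mul0r addr0.
rewrite addnS -natr1 mulrDl mul1r.
have := increment_noninc (leq_addr n j).
by move: ih je; rewrite /increment; lra.
Qed.

(* Kolmogorov-Sinai: W j reads the letters in the window [-j, j). *)
Lemma growth_rate_itinerary_le (I : finType) (f : Z -> I)
    (W : forall j, Z -> {ffun 'I_(j + j) -> A}) :
  fin_measurable f -> (forall j, fin_measurable (@W j)) ->
  (forall j z, W j (iter j T z) = word (j + j) z) ->
  (forall e, 0 < e -> exists j, cent mu f (@W j) <= e) ->
  (growth_rate (fun n => ent mu (itinerary f n)) <= entropy_rate%:E)%E.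
Proof.
move=> mf mW WT fW; apply/lee_addgt0Pr => e e0.
have [j hj] := fW (e / 2) (divr_gt0 e0 (ltr0Sn R 1)).
have [i hi] := entropy_rate_approx (divr_gt0 e0 (ltr0Sn R 1)).
rewrite -EFinD.
apply: (@growth_rate_le _ _ _ (ent mu (word i) + (j + j)%:R * `|entropy_rate + e / 2|) i) => n inn.
have mfn := fin_measurable_itinerary (n := n) mf.
have mWn := fin_measurable_itinerary (n := n) (@mW j).
have h1 : ent mu (itinerary f n) <=
    ent mu (itinerary (@W j) n) + cent mu (itinerary f n) (itinerary (@W j) n).
  rewrite -chain_rule; apply: ent_determined_le => //; first exact: fin_measurable_pair.
  by move=> z z' [].
have h2 : cent mu (itinerary f n) (itinerary (@W j) n) <= n%:R * (e / 2).
  apply: (@le_trans _ _ (\sum_(k < n) cent mu (fun z => f (iter k T z)) (itinerary (@W j) n))).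
    have := @cent_ffun_le _ _ _ mu mu1 I _ (fun k z => f (iter k T z)) _ n
      (fun k => fin_measurable_iter k mf) mWn.
    exact.
  rewrite mulr_natl -[X in _ *+ X]card_ord -sumr_const; apply: ler_sum => k _.
  apply: le_trans hj; rewrite -(cent_iter k mf (@mW j)).
  apply: (cent_le_cond mu1) => //; try exact: fin_measurable_iter.
  by move=> z z' /itinerary_eqP; apply.
(* Moved forward by [j], the [n] windows of width [j + j] read only letters of index below
   [n + (j + j)]. *)
have h3 : ent mu (itinerary (@W j) n) <= ent mu (word (n + (j + j))).
  rewrite -(ent_iter j mWn); apply: ent_determined_le => // z z' /itinerary_eqP h.
  apply/itinerary_eqP => k kn; rewrite -!iterD addnC !iterD !WT.
  apply/itinerary_eqP => l lj; rewrite -!iterD; apply: h.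
  by rewrite addnC -addSn leq_add// ltnW.
have h4 : ent mu (word (n + (j + j))) <=
    ent mu (word i) + (n + (j + j) - i)%:R * (entropy_rate + e / 2).
  by have := hi (n + (j + j) - i)%N; rewrite subnKC// (leq_trans inn)// leq_addr.
have er0 : 0 <= entropy_rate.
  by apply: lb_le_inf; [exists (increment 0), 0%N|move=> _ [k _ <-]; exact: increment_ge0].
have h5 : (n + (j + j) - i)%:R * (entropy_rate + e / 2) <=
    (n + (j + j))%:R * (entropy_rate + e / 2).
  by rewrite ler_wpM2r ?ler_nat ?leq_subr// addr_ge0// divr_ge0// ltW.
have h6 := ler_norm (entropy_rate + e / 2).
have h7 : (j + j)%:R * (entropy_rate + e / 2) <= (j + j)%:R * `|entropy_rate + e / 2|.
  by rewrite ler_wpM2l.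
move: h5; rewrite natrD; lra.
Qed.

End Letter.
End Itinerary.

(** * Independence, and block entropies given a quotient map *)

Section Independence.
Context d (T : measurableType d) (R : realType) (P : {measure set T -> \bar R}).
Hypothesis P1 : P [set: T] = 1%E.
Variables (I J : finType) (f : T -> I) (g : T -> J).
Hypotheses (mf : fin_measurable f) (mg : fin_measurable g).

Lemma ent_independent :
  (forall i j, law P (fun z => (f z, g z)) (i, j) = law P f i * law P g j) ->
  ent P (fun z => (f z, g z)) = ent P f + ent P g.
Proof.
move=> fg; rewrite !entE -opprD; congr (- _).
have xyln (x y : R) : 0 <= x -> 0 <= y ->
    (x * y) * ln (x * y) = y * (x * ln x) + x * (y * ln y).
  rewrite le_eqVlt => /predU1P[<- _|x0]; first by rewrite !mul0r mulr0 addr0.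
  rewrite le_eqVlt => /predU1P[<-|y0]; first by rewrite mulr0 !mul0r mulr0 addr0.
  by rewrite lnM//; ring.
rewrite (eq_bigr (fun x => law P g x.2 * (law P f x.1 * ln (law P f x.1)) +
    law P f x.1 * (law P g x.2 * ln (law P g x.2)))); last first.
  by move=> [i j] _; rewrite fg xyln// law_ge0.
rewrite big_split/=; congr (_ + _).
  rewrite -(pair_bigA _ (fun i j => law P g j * (law P f i * ln (law P f i))))/=.
  by apply: eq_bigr => i _; rewrite -mulr_suml sum_law// mul1r.
rewrite -(pair_bigA _ (fun i j => law P f i * (law P g j * ln (law P g j))))/=.
by rewrite exchange_big; apply: eq_bigr => j _; rewrite -mulr_suml sum_law// mul1r.
Qed.

(** The equality case of subadditivity, obtained from [ent_modular] relative to a constant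
    function. *)
Lemma independent_ent i j : ent P f + ent P g <= ent P (fun z => (f z, g z)) ->
  law P (fun z => (f z, g z)) (i, j) = law P f i * law P g j.
Proof.
move=> h.
have mt : fin_measurable (fun _ : T => tt) by exact: fin_measurable_cst.
have fgt : (fun _ : T => tt) @^-1` [set tt] = setT by exact/seteqP.
have Pt : P ((fun _ : T => tt) @^-1` [set tt]) = 1%E by rewrite fgt.
have mfg := fin_measurable_pair mf mg.
have := @ent_modular _ _ _ _ P1 _ _ _ _ _ _ mf mg mt i j tt.
rewrite (ent_pair_constant P1 mf mt Pt) (ent_pair_constant P1 mg mt Pt).
rewrite (ent_pair_constant P1 mfg mt Pt) (ent_constant P1 mt Pt) addr0.
move=> /(_ h); have -> : law P (fun _ : T => tt) tt = 1 by rewrite /law Pt.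
rewrite divr1.
have lawt (K : finType) (u : T -> K) v : law P (fun z => (u z, tt)) (v, tt) = law P u v.
  by rewrite /law; congr (fine (P _)); apply/seteqP; split => z /= [->].
have -> : law P (fun z => (f z, g z, tt)) (i, j, tt) =
    law P (fun z => (f z, g z)) (i, j) by exact: (lawt _ (fun z => (f z, g z))).
by rewrite !lawt.
Qed.

End Independence.

Section Conditional_itinerary.
Context dZ (Z : measurableType dZ) (R : realType) (mu : {measure set Z -> \bar R}).
Hypothesis mu1 : mu [set: Z] = 1%E.
Variable T : Z -> Z.
Hypothesis mT : measurable_fun [set: Z] T.
Hypothesis muT : invariant_measure mu T.
Variables (A : finType) (C : Z -> A).
Hypothesis mC : fin_measurable C.

Let word := itinerary T C.
Let mword n : fin_measurable (word n). Proof. exact: fin_measurable_itinerary. Qed.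

Context dY (Y : measurableType dY) (nu : {measure set Y -> \bar R}).
Hypothesis nu1 : nu [set: Y] = 1%E.
Variables (q : Z -> Y) (k : R.-pker Y ~> Z).
Hypothesis mq : measurable_fun [set: Z] q.
Hypothesis m1Y : forall y : Y, measurable [set y].
Hypothesis muE : forall B, measurable B -> mu B = (\int[nu]_y k y B)%E.
Hypothesis k_fiber : {ae nu, forall y, k y (q @^-1` [set y]) = 1%E}.

Definition block_entropy n := \int[nu]_(y in [set: Y]) ent (k y) (itinerary T C n).

Lemma block_entropy_ge0 n : 0 <= block_entropy n.
Proof.
by apply: Rintegral_ge0 => y _; apply: ent_ge0; [exact: prob_kernel|exact: mword].
Qed.

Lemma block_entropy_le n : block_entropy n <= ent mu (word n).
Proof.
have mt : fin_measurable (fun _ : Y => tt) by exact: fin_measurable_cst.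
apply: le_trans (expectation_ent_fiber_le mu1 nu1 mq m1Y muE k_fiber (@mword n) mt) _.
by apply: (cent_le_ent mu1) => //; exact: (fin_measurable_fiber mq mt).
Qed.

(* Phi rebuilds q after n steps from q and the n letters read meanwhile. *)
Lemma block_entropy_subadditive (Phi : forall n, Y -> {ffun 'I_n -> A} -> Y) :
  (forall n w, measurable_fun [set: Y] (fun y => Phi n y w)) ->
  (forall n z, q (iter n T z) = Phi n (q z) (word n z)) ->
  forall n m, block_entropy (n + m) <= block_entropy n + block_entropy m.
Proof.
move=> mPhi PhiE n m; apply/ler_addgt0Pr => e e0.
have e20 : 0 < e / 2 by exact: divr_gt0.
have [J1 [G1 [mG1 h1]]] :=
  cent_fiber_approximation mu1 nu1 mq m1Y muE k_fiber (@mword n) e20.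
have [J2 [G2 [mG2 h2]]] :=
  cent_fiber_approximation mu1 nu1 mq m1Y muE k_fiber (@mword m) e20.
(* The cell of [y] must also reveal [G2] after [n] steps, which depends on the word read; so [G2] is
   recorded for all words at once. *)
pose G y := (G1 y, [ffun w => G2 (Phi n y w)]).
have mG : fin_measurable G.
  apply: fin_measurable_pair => //; apply: fin_measurable_ffun => w j.
  rewrite -[X in measurable X]setTI.
  by have := @mPhi n w measurableT _ (mG2 j).
have mGq := fin_measurable_fiber mq mG; have mG1q := fin_measurable_fiber mq mG1.
have mG2q := fin_measurable_fiber mq mG2.
have mwm := fin_measurable_iter mT n (@mword m).
have mG2n := fin_measurable_iter mT n mG2q.
have mwG := fin_measurable_pair (@mword n) mGq.
have h3 : cent mu (word n) (fun z => G (q z)) <= block_entropy n + e / 2.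
  by apply: le_trans h1; apply: (cent_le_cond mu1) => // z z' [].
have h4 : cent mu (fun z => word m (iter n T z)) (fun z => (word n z, G (q z))) <=
    block_entropy m + e / 2.
  apply: le_trans h2; rewrite -(cent_iter mT muT n (@mword m) mG2q).
  apply: (cent_le_cond mu1) => // z z' zz'.
  have /= zz := congr1 fst zz'.
  have /= /ffunP/(_ (word n z)) := congr1 (fun x => x.2.2) zz'.
  by rewrite !ffunE !PhiE {2}zz.
have h5 := expectation_ent_fiber_le mu1 nu1 mq m1Y muE k_fiber (@mword (n + m)) mG.
apply: le_trans h5 _.
have : cent mu (word (n + m)) (fun z => G (q z)) <=
    cent mu (fun z => (word n z, word m (iter n T z))) (fun z => G (q z)).
  apply: (cent_determined_le mu1) => //; first exact: fin_measurable_pair.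
  by move=> z z' [h h']; apply/itinerary_addP.
have : ent mu (fun z => (word n z, word m (iter n T z), G (q z))) =
    ent mu (fun z => (word m (iter n T z), (word n z, G (q z)))).
  apply: (ent_determined mu1); last first.
      move=> z z'; split=> /pair_equal_spec[].
        by move=> -> /pair_equal_spec[-> ->].
      by move=> /pair_equal_spec[-> ->] ->.
    exact: (fin_measurable_pair mwm mwG).
  exact: (fin_measurable_pair (fin_measurable_pair (@mword n) mwm) mGq).
by move: h3 h4; rewrite /cent; lra.
Qed.

Section Past.
Variable L : forall j, Z -> {ffun 'I_j -> A}.
Hypothesis mL : forall j, fin_measurable (@L j).
Hypothesis LT : forall j z, L j (iter j T z) = word j z.

(** Since [L j] is a function of [q z], [block_entropy n] is at most the entropy of [n] letters
    given [L j], an increment of the word entropy. Summing such increments bounds [j] times it by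
    the entropy of words of length [j * n]. *)
Lemma block_entropy_growth_rate_ge (G : forall j, Y -> {ffun 'I_j -> A}) :
  (forall j, fin_measurable (@G j)) -> (forall j z, L j z = G j (q z)) ->
  forall n, (0 < n)%N ->
  ((n%:R^-1 * block_entropy n)%:E <= growth_rate (fun n => ent mu (word n)))%E.
Proof.
move=> mG LG n n0; have h j : block_entropy n <= ent mu (word (j + n)) - ent mu (word j).
  rewrite -(cent_itinerary_past mu1 mT muT mC mL LT).
  have -> : L j = (fun z => G j (q z)) by apply/funext => z.
  exact: (expectation_ent_fiber_le mu1 nu1 mq m1Y muE k_fiber (@mword n) (@mG j)).
have h' j : j%:R * block_entropy n <= ent mu (word (j * n)).
  elim: j => [|j ih]; first by rewrite mul0r; exact: ent_ge0.
  by rewrite mulSn addnC -natr1; have := h (j * n)%N; lra.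
apply: growth_rate_ge => N; exists (N.+1 * n)%N.
  by apply: leq_trans (leq_pmulr _ n0); exact: leqnSn.
rewrite muln_gt0 n0/=; apply: le_trans (h' N.+1).
by rewrite natrM -mulrA mulVKf// pnatr_eq0 -lt0n.
Qed.

(** As [G \o q] is nearly determined by a long past block, the triangle inequality for [cent]
    transfers the lower bound from past blocks to [q]. *)
Lemma entropy_rate_le_block_entropy n :
  (forall (J : finType) (G : Y -> J), fin_measurable G ->
     forall e : R, 0 < e -> exists j, cent mu (fun z => G (q z)) (@L j) <= e) ->
  n%:R * entropy_rate mu T C <= block_entropy n.
Proof.
move=> GL; apply/ler_addgt0Pr => e e0.
have e20 : 0 < e / 2 by exact: divr_gt0.
have [J [G [mG h1]]] :=
  cent_fiber_approximation mu1 nu1 mq m1Y muE k_fiber (@mword n) e20.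
have [j h2] := GL J G mG (e / 2) e20.
have h3 := entropy_rate_le mu1 mT muT mC mL LT j n.
rewrite -(cent_itinerary_past mu1 mT muT mC mL LT) in h3.
have := cent_trans mu1 (@mword n) (fin_measurable_fiber mq mG) (@mL j).
by move: h1 h2 h3; rewrite /block_entropy; lra.
Qed.

End Past.
End Conditional_itinerary.

Section Two_disintegrations.
Context dZ (Z : measurableType dZ) (R : realType) (mu : {measure set Z -> \bar R}).
Hypothesis mu1 : mu [set: Z] = 1%E.
Context dY (Y : measurableType dY) (nu : {measure set Y -> \bar R}).
Hypothesis nu1 : nu [set: Y] = 1%E.
Variables (q : Z -> Y) (k : R.-pker Y ~> Z).
Hypothesis mq : measurable_fun [set: Z] q.
Hypothesis m1Y : forall y : Y, measurable [set y].
Hypothesis muE : forall B, measurable B -> mu B = (\int[nu]_y k y B)%E.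
Hypothesis k_fiber : {ae nu, forall y, k y (q @^-1` [set y]) = 1%E}.
Context dY' (Y' : measurableType dY') (nu' : {measure set Y' -> \bar R}).
Hypothesis nu'1 : nu' [set: Y'] = 1%E.
Variables (q' : Z -> Y') (k' : R.-pker Y' ~> Z).
Hypothesis mq' : measurable_fun [set: Z] q'.
Hypothesis m1Y' : forall y : Y', measurable [set y].
Hypothesis muE' : forall B, measurable B -> mu B = (\int[nu']_y k' y B)%E.
Hypothesis k'_fiber : {ae nu', forall y, k' y (q' @^-1` [set y]) = 1%E}.
Variables (I : finType) (f : Z -> I).
Hypothesis mf : fin_measurable f.

(** By independence, conditioning on [G \o q'] does not lower the entropy of [f] under [k y].
    Concavity compares this with [mu], and a well chosen [G] compares [mu] with [k']. *)
Lemma expectation_ent_le_of_independent :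
  (forall (J : finType) (G : Y' -> J), fin_measurable G ->
    {ae nu, forall y, ent (k y) (fun z => (f z, G (q' z))) =
                      ent (k y) f + ent (k y) (fun z => G (q' z))}) ->
  \int[nu]_(y in [set: Y]) ent (k y) f <= \int[nu']_(y in [set: Y']) ent (k' y) f.
Proof.
move=> hG; apply/ler_addgt0Pr => e e0.
have [J [G [mG h]]] :=
  cent_fiber_approximation mu1 nu'1 mq' m1Y' muE' k'_fiber mf e0.
apply: le_trans h; have mGq := fin_measurable_fiber mq' mG.
apply: le_trans (expectation_cent_le mu1 nu1 muE mf mGq).
apply: expectation_le_ae => //; first exact: bounded_measurable_ent.
  by apply: bounded_measurableB; apply: bounded_measurable_ent => //;
    exact: fin_measurable_pair.
by apply: filterS (hG J G mG) => y hy; rewrite /cent hy addrK.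
Qed.

(** Since [q] factors through [q'], knowing [e (q' z)] besides [q z] lowers the mean entropy of [f]
    at most as far as knowing [q' z], that is, not at all. The drop [D] is nonnegative, so it
    vanishes a.e. *)
Lemma independent_of_expectation_ent_le (J : finType) (e : Y' -> J) (r : Y' -> Y) :
  fin_measurable e -> measurable_fun [set: Y'] r -> (forall z, q z = r (q' z)) ->
  \int[nu]_(y in [set: Y]) ent (k y) f <= \int[nu']_(y in [set: Y']) ent (k' y) f ->
  {ae nu, forall y, forall i j, law (k y) (fun z => (f z, e (q' z))) (i, j) =
     law (k y) f i * law (k y) (fun z => e (q' z)) j}.
Proof.
move=> me mr qr hle; have k1 y : k y [set: Z] = 1%E by exact: prob_kernel.
have meq := fin_measurable_fiber mq' me.
have mfe := fin_measurable_pair mf meq.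
have bf := bounded_measurable_ent k mf; have be := bounded_measurable_ent k meq.
have bfe := bounded_measurable_ent k mfe.
have hle' : \int[nu']_(y in [set: Y']) ent (k' y) f <=
    \int[nu]_(y in [set: Y]) cent (k y) f (fun z => e (q' z)).
  apply/ler_addgt0Pr => c c0.
  (* A [G] that is good for the pair suffices: the entropy of [e] alone is subtracted, and for it
     the bound [h2], valid for every [G], has the right direction. *)
  have [K [G [mG h]]] := cent_fiber_approximation mu1 nu1 mq m1Y muE k_fiber mfe c0.
  have h2 := expectation_ent_fiber_le mu1 nu1 mq m1Y muE k_fiber meq mG.
  pose G' y := (e y, G (r y)).
  have mGr : fin_measurable (fun y => G (r y)) by exact: (fin_measurable_fiber mr mG).
  have mG' : fin_measurable G' by exact: fin_measurable_pair.
  have h3 := expectation_ent_fiber_le mu1 nu'1 mq' m1Y' muE' k'_fiber mf mG'.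
  apply: le_trans h3 _; rewrite /cent expectationB//.
  have mGq := fin_measurable_fiber mq mG.
  have -> : (fun z => (f z, G' (q' z))) = (fun z => (f z, (e (q' z), G (q z)))).
    by apply/funext => z; rewrite /G' qr.
  have -> : (fun z => G' (q' z)) = (fun z => (e (q' z), G (q z))).
    by apply/funext => z; rewrite /G' qr.
  have : ent mu (fun z => (f z, (e (q' z), G (q z)))) =
      ent mu (fun z => (f z, e (q' z), G (q z))).
    apply: (ent_determined mu1); last by move=> z z'; split=> [[-> -> ->]|[-> -> ->]].
      by apply: fin_measurable_pair => //; exact: fin_measurable_pair.
    exact: fin_measurable_pair.
  by move: h h2; rewrite /cent/=; lra.
pose D y := ent (k y) f - cent (k y) f (fun z => e (q' z)).
have : {ae nu, forall y, D y = 0}.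
  apply: (expectation_eq0_ae nu1).
  - by apply: bounded_measurableB => //; exact: bounded_measurableB.
  - by move=> y; rewrite subr_ge0 cent_le_ent.
  - rewrite expectationB//; last exact: bounded_measurableB.
    by rewrite subr_le0; exact: le_trans hle hle'.
apply: filterS => y Dy i j; apply: (independent_ent (k1 y)) => //.
by move: Dy; rewrite /D /cent; lra.
Qed.

End Two_disintegrations.

(** * Borel structure of the shift space *)

Section Borel.
Variable R : realType.

Lemma borel_measurable_fun d (T : measurableType d) (U : ptopologicalType)
    (f : T -> borel U) :
  (forall V : set U, open V -> measurable (f @^-1` V)) -> measurable_fun [set: T] f.
Proof.
move=> h; apply: (@measurability _ _ T (borel U) [set: T] f (@open U)) => // _ [V oV <-].
by rewrite setTI; exact: h.
Qed.

Lemma borel_open (U : ptopologicalType) (V : set U) :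
  open V -> measurable (V : set (borel U)).
Proof. by move=> oV; exact: sub_sigma_algebra. Qed.

Lemma borel_set1 (U : pmetricType R) (x : U) : measurable ([set x] : set (borel U)).
Proof.
rewrite -[X in measurable X]setCK; apply: measurableC; apply: borel_open.
apply: closed_openC; apply: accessible_closed_set1.
exact/hausdorff_accessible/metric_hausdorff.
Qed.

Lemma compact_mdist_bounded (X : pmetricType R) : compact [set: X] ->
  exists M : R, forall x y : X, mdist x y <= M.
Proof.
rewrite compact_cover => /(_ _ [set: nat] (fun n => ball (point : X) n%:R)) [].
- move=> n _; have [->|n0] := posnP n.
    rewrite (_ : ball _ _ = set0); first exact: open0.
    by apply/seteqP; split => // y; rewrite ballEmdist/= ltNge mdist_ge0.
  rewrite openE => y; rewrite ballEmdist/= => py.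
  apply/nbhs_ballP; exists (n%:R - mdist point y) => /=; first by rewrite subr_gt0.
  move=> z; rewrite !ballEmdist/= => yz.
  by rewrite (le_lt_trans (metric_triangle _ y _))// -ltrBrDl.
- move=> y _; exists (Num.truncn (mdist point y)).+1 => //.
  by rewrite ballEmdist/= truncnS_gt.
move=> D _ cover; pose N := \max_(n <- finmap.enum_fset D) n.
have yN (y : X) : mdist point y <= N%:R.
  have [n nD] := cover y I; rewrite ballEmdist/= => /ltW/le_trans; apply.
  by rewrite ler_nat; exact: leq_bigmax_seq.
exists (N%:R + N%:R) => x y; rewrite (le_trans (metric_triangle _ point _))//.
by rewrite lerD// metric_sym.
Qed.

(** Turns a Holder bound into a modulus of continuity; dividing by [|C| + 1] also covers constants
    [C <= 0]. *)
Lemma powR_small (C a e : R) : 0 < a -> 0 < e ->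
  exists2 s : R, 0 < s & forall t, 0 <= t -> t < s -> C * t `^ a < e.
Proof.
move=> a0 e0; pose b := e / (`|C| + 1).
have C0 : 0 < `|C| + 1 by rewrite ltr_wpDl.
have b0 : 0 < b by rewrite divr_gt0.
exists (b `^ a^-1); first exact: powR_gt0.
move=> t t0 tb; have : t `^ a < b.
  rewrite -[ltRHS](@powRr1 _ b) ?ltW// -(@mulVf _ a) ?gt_eqF// powRrM.
  by rewrite gt0_ltr_powR// nnegrE ?powR_ge0.
move=> h; apply: (@le_lt_trans _ _ ((`|C| + 1) * t `^ a)).
  by rewrite ler_wpM2r ?powR_ge0// (le_trans (ler_norm C))// lerDl.
by rewrite mulrC -ltr_pdivlMr.
Qed.

End Borel.

Section Coordinate_space.
Variables (R : realType) (I A : Type) (T : pmetricType R).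
Variables (depth : I -> nat) (coord : T -> I -> A).
(** The two-sided shift and the space of pasts are treated together, both distances being instances
    of [coord_dist]. *)
Hypothesis mdistE : forall x y : T, mdist x y = coord_dist R depth coord x y.

Lemma agree_mdist_le n (x y : T) : agree depth coord n x y -> mdist x y <= 2^-1 ^+ n.
Proof.
move=> xy; rewrite mdistE; apply: ge_inf; last by exists n.
by exists 0 => _ [m _ <-]; rewrite exprn_ge0.
Qed.

Lemma mdist_lt_agree n (x y : T) : mdist x y < 2^-1 ^+ n -> agree depth coord n x y.
Proof. by rewrite mdistE; exact: coord_dist_agree. Qed.

Lemma agree_small (e : R) : 0 < e ->
  exists n, forall x y : T, agree depth coord n x y -> mdist x y < e.
Proof.
move=> e0; have : (fun n => (2^-1 : R) ^+ n) @ \oo --> (0 : R).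
  by apply: cvg_expr; rewrite ger0_norm// invf_lt1// ltr1n.
move/cvgrPdist_lt => /(_ _ e0)[N _ /(_ N (leqnn N))] /=.
rewrite sub0r normrN ger0_norm ?exprn_ge0// => Ne.
by exists N => x y /agree_mdist_le h; exact: le_lt_trans Ne.
Qed.

Lemma open_agree (U : set T) x : open U -> U x ->
  exists n, forall y, agree depth coord n x y -> U y.
Proof.
rewrite openE => oU /oU /nbhs_ballP[e /= e0 xU].
have [n hn] := agree_small e0; exists n => y xy; apply: xU.
by rewrite ballEmdist/=; exact: hn.
Qed.

Lemma agree_open n (U : set T) :
  (forall x y, agree depth coord n x y -> U x -> U y) -> open U.
Proof.
move=> hU; rewrite openE => x Ux; apply/nbhs_ballP.
exists (2^-1 ^+ n) => /=; first by rewrite exprn_gt0.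
by move=> y; rewrite ballEmdist/= => /mdist_lt_agree/hU; apply.
Qed.

Lemma agree_sym n x y : agree depth coord n x y -> agree depth coord n y x.
Proof. by move=> xy i /xy. Qed.

Lemma agree_fin_measurable n (J : finType) (f : borel T -> J) :
  (forall x y, agree depth coord n x y -> f x = f y) -> fin_measurable f.
Proof.
move=> hf j; apply: borel_open; apply: (@agree_open n).
by move=> x y /hf /= ->.
Qed.

Variables (J : nat -> finType) (W : forall n, borel T -> J n).
(** The levels in the two hypotheses differ by one because [window n] reads the indices from [-n] to
    [n - 1], and [-n] has depth [n]. *)
Hypothesis W_agree : forall n x y, W n x = W n y -> agree depth coord n x y.
Hypothesis agree_W : forall n x y, agree depth coord n.+1 x y -> W n x = W n y.

Lemma agree_window_measurable n : fin_measurable (@W n).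
Proof. by apply: (@agree_fin_measurable n.+1) => x y; exact: agree_W. Qed.

Lemma open_bigcup_window (U : set T) : open U ->
  U = \bigcup_n (@W n @^-1` [set v | @W n @^-1` [set v] `<=` U]).
Proof.
move=> oU; apply/seteqP; split => [x Ux|x [n _ /=]]; last exact.
have [n hn] := open_agree oU Ux; exists n => // y /= yx; apply: hn.
by apply: agree_sym; exact: W_agree.
Qed.

(** An open set is a countable union of sets that are read off from a single window, hence trivially
    approximable. *)
Lemma borel_approximable (mu : {measure set (borel T) -> \bar R}) :
  mu [set: borel T] = 1%E ->
  (forall i j, (i <= j)%N -> forall z z', @W j z = @W j z' -> @W i z = @W i z') ->
  @measurable _ (borel T) `<=` approximable mu W.
Proof.
move=> mu1 Wr; apply: smallest_sub.
  by apply: approximable_sigma_algebra => //; exact: agree_window_measurable.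
move=> U /= oU; rewrite (open_bigcup_window oU).
have mW := agree_window_measurable.
apply: approximable_bigcup => // n; split => [|e e0].
  by apply: fin_measurable_preimage; exact: mW.
exists n; apply: (le_trans (cent_determined_le0 mu1 (mW n) _)); last exact: ltW.
by move=> z z' zz'; rewrite /= zz'.
Qed.

(* The product sigma-algebra contains the open sets because T is second countable. *)
Lemma open_prod_measurable (X : ptopologicalType) (O : set (T * X)) :
  (forall x t, O (x, t) -> exists n (V : set X), [/\ open V, V t &
     forall y s, agree depth coord n x y -> V s -> O (y, s)]) ->
  measurable (O : set (borel T * borel X)).
Proof.
move=> hO.
pose V n v := interior [set t : X | forall y, @W n y = v -> O (y, t)].
rewrite (_ : O = \bigcup_n \bigcup_(v in [set: J n]) ((@W n @^-1` [set v]) `*` V n v)).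
  apply: bigcupT_measurable => n; apply: fin_bigcup_measurable => [|v _].
    exact: finite_finset.
  apply: measurableX; first exact: agree_window_measurable.
  by apply: borel_open; exact: open_interior.
apply/seteqP; split => [[x t] Oxt|[x t] [n _ [v _ [/= xv /interior_subset]]]].
  have [n [U [oU Ut h]]] := hO _ _ Oxt; exists n => //; exists (W n x) => //; split => //=.
  move: oU; rewrite openE => /(_ _ Ut); apply: interiorS.
  by move=> s Us y yx; apply: h => //; apply: W_agree.
by apply.
Qed.

End Coordinate_space.

Lemma agree_measurable_fun (R : realType) (I A I' A' : Type) (T T' : pmetricType R)
  (depth : I -> nat) (coord : T -> I -> A) (depth' : I' -> nat) (coord' : T' -> I' -> A')
  (f : T -> T') :
  (forall x y : T, mdist x y = coord_dist R depth coord x y) ->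
  (forall x y : T', mdist x y = coord_dist R depth' coord' x y) ->
  (forall n, exists m, forall x y, agree depth coord m x y ->
    agree depth' coord' n (f x) (f y)) ->
  measurable_fun [set: borel T] (f : borel T -> borel T').
Proof.
move=> dE dE' hf; apply: borel_measurable_fun => V oV; apply: borel_open.
rewrite openE => x Vfx; have [n hn] := open_agree dE' oV Vfx.
have [m hm] := hf n; apply/nbhs_ballP.
exists (2^-1 ^+ m) => /=; first by rewrite exprn_gt0.
by move=> y; rewrite ballEmdist/= => /(mdist_lt_agree dE) /hm /hn.
Qed.

Section Shift_space.
Variables (R : realType) (S : markov_shift).
Notation Sigma := (shift_space R S).
Notation Past := (past_space R S).

Lemma shift_mdistE (x y : Sigma) : mdist x y = coord_dist R absz (@letter R S) x y.
Proof. by []. Qed.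

Lemma past_mdistE (x y : Past) : mdist x y = coord_dist R id (@past_letter R S) x y.
Proof. by []. Qed.

Lemma letter_iter n (w : Sigma) i :
  letter (iter n (@left_shift R S) w) i = letter w (i + n%:Z).
Proof.
elim: n i => [|n ih] i; first by rewrite addr0.
rewrite iterS (_ : letter (left_shift _) i =
  letter (iter n (@left_shift R S) w) (i + 1))// ih.
by congr letter; lia.
Qed.

Lemma left_shift_measurable :
  measurable_fun [set: borel Sigma] (@left_shift R S : borel Sigma -> borel Sigma).
Proof.
apply: (agree_measurable_fun shift_mdistE shift_mdistE) => n.
exists n.+1 => x y xy i ni.
have -> : letter (left_shift x) i = letter x (i + 1) by [].
have -> : letter (left_shift y) i = letter y (i + 1) by [].
by apply: xy; lia.
Qed.

Lemma past_measurable :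
  measurable_fun [set: borel Sigma] (@past R S : borel Sigma -> borel Past).
Proof.
apply: (agree_measurable_fun shift_mdistE past_mdistE) => n.
exists n.+1 => x y xy i ni.
by apply: (xy (Negz i)).
Qed.

Definition letter0 (w : borel Sigma) : symbol S := @letter R S w 0.

Lemma letter0_measurable : fin_measurable letter0.
Proof.
by apply: (agree_fin_measurable shift_mdistE (n := 1%N)) => x y; apply.
Qed.

Definition window n (w : borel Sigma) : {ffun 'I_(n + n) -> symbol S} :=
  [ffun i : 'I_(n + n) => @letter R S w ((i : nat)%:Z - n%:Z)].

Lemma window_agree n x y : window n x = window n y -> agree absz (@letter R S) n x y.
Proof.
move=> /ffunP h i ni; have ilt : (`|(i + n%:Z)%R| < n + n)%N by lia.
have := h (Ordinal ilt); rewrite !ffunE /=.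
by have -> : `|(i + n%:Z)%R|%:Z - n%:Z = i by lia.
Qed.

Lemma agree_window n x y : agree absz (@letter R S) n.+1 x y -> window n x = window n y.
Proof. by move=> h; apply/ffunP => i; rewrite !ffunE; apply: h; have := ltn_ord i; lia. Qed.

Lemma window_refine i j : (i <= j)%N ->
  forall z z', window j z = window j z' -> window i z = window i z'.
Proof.
move=> ij z z' /ffunP h; apply/ffunP => k; rewrite !ffunE.
have klt : (k + (j - i) < j + j)%N by have := ltn_ord k; lia.
have := h (Ordinal klt); rewrite !ffunE /=.
by have -> : (k + (j - i))%N%:Z - j%:Z = k%:Z - i%:Z by lia.
Qed.

(* past_letter p m is the letter of index - m - 1, so these are the letters
   of index -j, ..., -1. *)
Definition past_block j (p : borel Past) : {ffun 'I_j -> symbol S} :=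
  [ffun i : 'I_j => @past_letter R S p (j - i).-1].

Lemma past_block_agree n x y :
  past_block n x = past_block n y -> agree id (@past_letter R S) n x y.
Proof.
move=> /ffunP h i /= ni; have ilt : (n - i.+1 < n)%N by lia.
have := h (Ordinal ilt); rewrite !ffunE /=.
by have -> : (n - (n - i.+1)).-1 = i by lia.
Qed.

Lemma agree_past_block n x y :
  agree id (@past_letter R S) n.+1 x y -> past_block n x = past_block n y.
Proof. by move=> h; apply/ffunP => i; rewrite !ffunE; apply: h; have := ltn_ord i; lia. Qed.

Lemma past_block_measurable n : fin_measurable (past_block n).
Proof.
by apply: (agree_fin_measurable past_mdistE (n := n.+1)) => x y; exact: agree_past_block.
Qed.

Lemma past_block_refine i j : (i <= j)%N ->
  forall z z', past_block j z = past_block j z' -> past_block i z = past_block i z'.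
Proof.
move=> ij z z' /ffunP h; apply/ffunP => k; rewrite !ffunE.
have klt : (k + (j - i) < j)%N by have := ltn_ord k; lia.
have := h (Ordinal klt); rewrite !ffunE /=.
by have -> : (j - (k + (j - i))).-1 = (i - k).-1 by lia.
Qed.

Lemma past_letter_admissible (p : Past) n :
  transition (past_letter p n.+1) (past_letter p n).
Proof.
have [w _ wp] := set_valP p; rewrite /past_letter -wp /=.
by have := letterP w (Negz n.+1); have -> : Negz n.+1 + 1 = Negz n by lia.
Qed.

(** The fiber maps will depend on letters of index at most 0 only, so after a past and the letter
    [a] any future starting with [a] will do. *)
Definition future_from (a : symbol S) : Sigma := xget point [set w | letter w 0 = a].

Definition concat (p : Past) (a : symbol S) (i : int) : symbol S :=
  match i with Posz n => letter (future_from a) n%:Z | Negz n => past_letter p n end.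

Lemma concat_admissible (p p' : Past) a : past_letter p 0 = past_letter p' 0 ->
  admissible (concat p a) -> admissible (concat p' a).
Proof.
move=> pp' h [n|[|n]].
- by have := h (Posz n).
- by have := h (Negz 0); rewrite /= pp'.
- have -> : Negz n.+1 + 1 = Negz n by lia.
  exact: past_letter_admissible.
Qed.

(** When [a] cannot follow [p] the value is immaterial. Which case applies is decided by the last
    letter of [p], so the function stays measurable. *)
Definition append (a : symbol S) (p : borel Past) : borel Sigma :=
  if pselect (admissible (concat p a)) is left h then mk_shift R h else point.

Lemma append_measurable a : measurable_fun [set: borel Past] (append a).
Proof.
apply: (agree_measurable_fun past_mdistE shift_mdistE) => n.
(* The successor makes [x] and [y] share the letter of index -1 even for [n = 0], so that both fall
   into the same case. *)
exists n.+1 => x y xy i ni; rewrite /append.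
have xy0 := xy 0%N isT.
case: pselect => hx; case: pselect => hy //.
- by case: i ni => [k|k] //= ni; apply: xy => /=; lia.
- by exfalso; apply: hy; exact: concat_admissible hx.
- by exfalso; apply: hx; exact: concat_admissible hy.
Qed.

Lemma append_past (w : Sigma) i : i <= 0 ->
  @letter R S (append (letter w 0) (past w)) i = letter w i.
Proof.
have f0 : letter (future_from (letter w 0)) 0 = letter w 0.
  by rewrite /future_from; case: xgetP => [v _ /= ->//|/(_ w)/(_ erefl)].
move=> i0; rewrite /append; case: pselect => [h|[]].
  by case: i i0 => [[|k]|k].
move=> [n|[|n]].
- exact: (letterP (future_from (letter w 0)) n).
- have := letterP w (Negz 0); have -> : Negz 0 + 1 = 0 by lia.
  by rewrite /= f0.
- have -> : Negz n.+1 + 1 = Negz n by lia.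
  exact: past_letter_admissible.
Qed.

End Shift_space.

(** * The skew product and its action on pasts *)

Section Skew.
Variables (R : realType) (S : markov_shift) (X : pmetricType R).
Variables (alpha : R) (F : shift_space R S -> X -> X).
Hypothesis compact_X : compact [set: X].
Hypothesis alpha_gt0 : 0 < alpha.
Hypothesis holder_fiber : forall w, holder (@mdist R X) (@mdist R X) alpha (F w).
Hypothesis holder_F : holder_continuous (@mdist R (shift_space R S)) (@sup_dist R X X) F.
Notation Sigma := (shift_space R S).
Notation Past := (past_space R S).

(** Joint continuity is checked through the intermediate value [F x r]: the Holder bound of [F x]
    controls the change of point, the uniform distance the change of base. *)
Lemma skew_fiber_measurable :
  measurable_fun [set: borel Sigma * borel X] (fun z => F z.1 z.2 : borel X).
Proof.
apply: borel_measurable_fun => V oV.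
apply: (open_prod_measurable (@shift_mdistE R S) (@window_agree R S) (@agree_window R S)).
move=> x t Vxt; rewrite /= in Vxt.
have /nbhs_ballP[e /= e0 eV] : nbhs (F x t) V by exact: open_nbhs_nbhs.
have e20 : 0 < e / 2 by rewrite divr_gt0.
have [a a0 [C hC]] := holder_F; have [D hD] := holder_fiber x.
have [s s0 hs] := powR_small C a0 e20; have [u u0 hu] := powR_small D alpha_gt0 e20.
have [n hn] := agree_small (@shift_mdistE R S) s0.
exists n, (ball t u)°; split; [exact: open_interior|exact: nbhsx_ballx|].
move=> y r xy /interior_subset; rewrite ballEmdist/= => tr.
apply: eV; rewrite ballEmdist/= [e]splitr.
apply: le_lt_trans (metric_triangle _ (F x r) _) _.
rewrite ltrD//; first by apply: le_lt_trans (hD _ _) _; apply: hu => //; exact: mdist_ge0.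
apply: le_lt_trans (hs (mdist x y) (mdist_ge0 _ _) (hn _ _ xy)).
apply: le_trans (hC x y); apply: ub_le_sup; last by exists r.
(* The supremum in [sup_dist] is an upper bound only for a bounded set; compactness ensures this. *)
have [M hM] := compact_mdist_bounded compact_X.
by exists M => _ [q _ <-]; exact: hM.
Qed.

Lemma skew_product_measurable : measurable_fun setT (skew_product F).
Proof.
apply/measurable_fun_pairP; split => //=.
  exact: (measurableT_comp (@left_shift_measurable R S) measurable_fst).
exact: skew_fiber_measurable.
Qed.

Lemma past_fst_measurable : measurable_fun setT (@past_fst R S X).
Proof. exact: (measurableT_comp (@past_measurable R S) measurable_fst). Qed.

Lemma past_prod_measurable : measurable_fun setT (@past_prod R S X).
Proof.
by apply/measurable_fun_pairP; split; [exact: past_fst_measurable|exact: measurable_snd].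
Qed.

Lemma past_prod_set1 (y : borel Past * borel X) : measurable [set y].
Proof.
case: y => p t; rewrite (_ : [set _] = [set p] `*` [set t]).
  by apply: measurableX; exact: borel_set1.
by apply/seteqP; split => [[a b] [-> ->]//|[a b] /= [-> ->]].
Qed.

(** One step seen from the past and the point of [X]: complete the past to a base point by the
    letter read, apply the skew product, forget the future. *)
Definition block_map1 (y : borel Past * borel X) (a : symbol S) :=
  past_prod (skew_product F (append a y.1, y.2)).

Fixpoint block_map n : borel Past * borel X -> {ffun 'I_n -> symbol S} ->
    borel Past * borel X :=
  match n with
  | 0 => fun y _ => y
  | n.+1 => fun y w => block_map (block_map1 y (w ord0)) [ffun i : 'I_n => w (lift ord0 i)]
  end.

Lemma block_map_measurable n (w : {ffun 'I_n -> symbol S}) :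
  measurable_fun setT (fun y => block_map y w).
Proof.
elim: n w => [|n ih] w /=; first exact: measurable_id.
apply: (measurableT_comp (ih [ffun i => w (lift ord0 i)])).
apply: measurableT_comp; first exact: past_prod_measurable.
apply: measurableT_comp; first exact: skew_product_measurable.
apply/measurable_fun_pairP; split; last exact: measurable_snd.
exact: (measurableT_comp (append_measurable _) measurable_fst).
Qed.

Definition letter0_fst (z : borel Sigma * borel X) : symbol S := letter0 z.1.

Lemma letter0_fst_measurable : fin_measurable letter0_fst.
Proof. exact: (fin_measurable_fiber measurable_fst (@letter0_measurable R S)). Qed.

Hypothesis past_F : forall w w' : shift_space R S,
  (forall i : int, i <= 0 -> letter w i = letter w' i) -> F w = F w'.

(** The completed base point is the true one at indices at most 0 only. This suffices for the new
    past, which reads exactly these, and by [past_F] for the fiber map. *)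
Lemma block_mapE n z : past_prod (iter n (skew_product F) z) =
  block_map (past_prod z) (itinerary (skew_product F) letter0_fst n z).
Proof.
elim: n z => [//|n ih] z; rewrite iterSr ih /=; congr block_map.
  rewrite /block_map1 ffunE /= /letter0_fst /letter0 /past_prod /=; congr pair.
    apply: past_letter_inj; apply/funext => k.
    have -> (w : Sigma) : past_letter (past (left_shift w)) k = letter w (Negz k + 1) by [].
    by apply/esym; apply: append_past; lia.
  by congr (_ z.2); apply: past_F => i i0; apply/esym; exact: append_past.
by apply/ffunP => i; rewrite !ffunE -iterSr.
Qed.

Lemma skew_product_iter_fst n z :
  (iter n (skew_product F) z).1 = iter n (@left_shift R S) z.1.
Proof. by elim: n => // n ih; rewrite !iterS /= ih. Qed.

End Skew.

(** * Generating pi-systems and uniqueness of measures and kernels *)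

Section Product_uniqueness.
Context d1 d2 (T1 : measurableType d1) (T2 : measurableType d2).

Lemma prod_measurable_generated (G1 : set (set T1)) (G2 : set (set T2)) :
  @measurable _ T1 = <<s G1 >> -> @measurable _ T2 = <<s G2 >> ->
  G1 setT -> G2 setT ->
  @measurable _ (T1 * T2)%type = <<s [set A `*` B | A in G1 & B in G2] >>.
Proof.
move=> m1 m2 GT1 GT2; set G := [set A `*` B | A in G1 & B in G2].
have mfst : measurable_fun setT (fst : g_sigma_algebraType G -> T1).
  apply: (@measurability _ _ (g_sigma_algebraType G) T1 setT fst G1) => //.
  move=> _ [A GA <-]; rewrite setTI; apply: sub_sigma_algebra.
  by exists A => //; exists setT => //; rewrite setXT.
have msnd : measurable_fun setT (snd : g_sigma_algebraType G -> T2).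
  apply: (@measurability _ _ (g_sigma_algebraType G) T2 setT snd G2) => //.
  move=> _ [A GA <-]; rewrite setTI; apply: sub_sigma_algebra.
  by exists setT => //; exists A => //; rewrite setTX.
apply/seteqP; split; last first.
  apply: smallest_sub; first exact: sigma_algebra_measurable.
  move=> _ [A GA [B GB <-]]; apply: measurableX.
    by rewrite m1; exact: sub_sigma_algebra.
  by rewrite m2; exact: sub_sigma_algebra.
rewrite measurable_prod_measurableType; apply: smallest_sub.
  exact: (@sigma_algebra_measurable _ (g_sigma_algebraType G)).
move=> _ [A mA [B mB <-]].
rewrite (_ : A `*` B = ([set: T1 * T2] `&` fst @^-1` A) `&` ([set: T1 * T2] `&` snd @^-1` B)).
  apply: (@measurableI _ (g_sigma_algebraType G)).
    exact: (mfst (@measurableT _ (g_sigma_algebraType G)) A mA).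
  exact: (msnd (@measurableT _ (g_sigma_algebraType G)) B mB).
by rewrite !setTI.
Qed.

Lemma product_measure_unique_generated (R : realType) (G1 : set (set T1)) (G2 : set (set T2))
    (m1 : {measure set T1 -> \bar R}) (m2 : probability T2 R)
    (m : {measure set (T1 * T2) -> \bar R}) :
  m1 [set: T1] = 1%E ->
  @measurable _ T1 = <<s G1 >> -> @measurable _ T2 = <<s G2 >> ->
  G1 setT -> G2 setT -> setI_closed G1 -> setI_closed G2 ->
  (forall A B, G1 A -> G2 B -> m (A `*` B) = (m1 A * m2 B)%E) ->
  forall B, measurable B -> m B = (m1 \x m2)%E B.
Proof.
move=> m11 mG1 mG2 GT1 GT2 GI1 GI2 mE.
have mA A : G1 A -> measurable A by rewrite mG1 => GA; exact: sub_sigma_algebra.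
have mB B : G2 B -> measurable B by rewrite mG2 => GB; exact: sub_sigma_algebra.
apply: (measure_unique [set A `*` B | A in G1 & B in G2] (fun=> setT)).
- exact: prod_measurable_generated.
- move=> _ _ [A GA [B GB <-]] [A' GA' [B' GB' <-]]; rewrite -setXI.
  by exists (A `&` A'); [exact: GI1|exists (B `&` B') => //; exact: GI2].
- by move=> _; exists setT => //; exists setT => //; rewrite setXTT.
- by rewrite bigcup_const.
- by move=> _ [A GA [B GB <-]]; rewrite mE//= product_measure1E//; [exact: mA|exact: mB].
- by move=> _; rewrite -setXTT mE// m11 probability_setT mule1 ltry.
Qed.

End Product_uniqueness.

(** Finite intersections of basic open sets, enumerated by coding finite sequences of indices.
    Countability matters: almost sure statements about all [E m] hold off one null set. *)
Lemma second_countable_pi_system (X : ptopologicalType) : @second_countable X ->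
  exists E : nat -> set X, [/\ range E setT, setI_closed (range E) &
    @measurable _ (borel X) = <<s range E >>].
Proof.
move=> [B /countable_injP[g ginj] [Bo Bb]].
pose f n : set X := xget setT [set U | B U /\ g U = n].
have fB U : B U -> f (g U) = U.
  move=> BU; rewrite /f; case: xgetP => [V _ [BV gVU]|/(_ U)[]//].
  by apply: ginj; rewrite ?inE.
have fo n : open (f n).
  by rewrite /f; case: xgetP => [V _ [/Bo]//|_]; exact: openT.
pose seq_of n : seq nat := odflt [::] (unpickle n).
pose E n := \bigcap_(i in [set` seq_of n]) f i.
have Epickle (s : seq nat) : E (pickle s) = \bigcap_(i in [set` s]) f i.
  by rewrite /E /seq_of pickleK.
have Eo n : open (E n).
  rewrite /E bigcap_seq; elim/big_ind : _ => //; [exact: openT|exact: openI].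
exists E; split.
- by exists (pickle ([::] : seq nat)) => //; rewrite Epickle set_nil bigcap_set0.
- move=> _ _ [m _ <-] [n _ <-]; exists (pickle (seq_of m ++ seq_of n)) => //.
  rewrite Epickle -bigcap_setU; congr (\bigcap_(i in _) f i).
  apply/seteqP; split => i /=; rewrite mem_cat; first by move/orP.
  by move=> h; apply/orP.
- apply/seteqP; split; apply: smallest_sub.
  + exact: (@sigma_algebra_measurable _ (g_sigma_algebraType (range E))).
  + move=> U oU; rewrite (_ : U = \bigcup_(n in [set n | f n `<=` U]) f n).
      apply: (@bigcup_measurable _ (g_sigma_algebraType (range E))) => n _.
      apply: sub_sigma_algebra; exists (pickle [:: n]) => //.
      rewrite Epickle (_ : [set` [:: n]] = [set n]) ?bigcap_set1//.
      by apply/seteqP; split => i /=; rewrite mem_seq1 => /eqP.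
    apply/seteqP; split => [x Ux|x [n /= fU /fU]//].
    have /(Bb x)[V [BV Vx] VU] : nbhs x U by exact: open_nbhs_nbhs.
    by exists (g V); rewrite /= fB.
  + exact: sigma_algebra_measurable.
  + by move=> _ [n _ <-]; apply: sub_sigma_algebra; exact: Eo.
Qed.

Section Window_pi_system.
Variables (R : realType) (S : markov_shift).
Notation Sigma := (shift_space R S).

(** Two cylinders are nested or disjoint, so adding [set0] makes a pi-system; [setT] is required of
    a factor in [product_measure_unique_generated]. *)
Definition window_cylinder : set (set (borel Sigma)) :=
  [set A | A = set0 \/ A = setT \/ exists n v, A = @window R S n @^-1` [set v]].

Lemma window_cylinder_setI : setI_closed window_cylinder.
Proof.
have atomI n m v v' : (n <= m)%N -> window_cylinder
    (@window R S n @^-1` [set v] `&` @window R S m @^-1` [set v']).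
  move=> nm; have [[x [/= xv xv']]|h] := pselect
      (exists x, (@window R S n @^-1` [set v] `&` @window R S m @^-1` [set v']) x).
    right; right; exists m, v'; apply/seteqP; split => [y []//|y /= yv']; split => //=.
    by rewrite -xv; apply: (window_refine nm); rewrite yv' xv'.
  by left; apply/seteqP; split => // x hx; apply: h; exists x.
move=> A B [->|[->|[n [v ->]]]]; first by rewrite set0I; left.
  by rewrite setTI.
move=> [->|[->|[m [v' ->]]]]; first by rewrite setI0; left.
  by rewrite setIT; right; right; exists n, v.
have [nm|/ltnW mn] := leqP n m; first exact: atomI.
by rewrite setIC; exact: atomI.
Qed.

Lemma window_cylinder_generated : @measurable _ (borel Sigma) = <<s window_cylinder >>.
Proof.
apply/seteqP; split; apply: smallest_sub.
- exact: (@sigma_algebra_measurable _ (g_sigma_algebraType window_cylinder)).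
- move=> U oU; rewrite (open_bigcup_window (@shift_mdistE R S) (@window_agree R S) oU).
  apply: (@bigcupT_measurable _ (g_sigma_algebraType window_cylinder)) => n.
  set V := [set v | _].
  rewrite (_ : _ @^-1` V = \bigcup_(v in V) (@window R S n @^-1` [set v])).
    apply: (@fin_bigcup_measurable _ (g_sigma_algebraType window_cylinder)).
      exact: finite_finset.
    by move=> v _; apply: sub_sigma_algebra; right; right; exists n, v.
  by apply/seteqP; split => [x Vx|x [v Vv /= xv]]; [exists (window n x)|rewrite /= xv].
- exact: sigma_algebra_measurable.
- have mW := agree_window_measurable (@shift_mdistE R S) (@agree_window R S).
  move=> _ [->|[->|[n [v ->]]]]; [exact: measurable0|exact: measurableT|exact: mW].
Qed.

End Window_pi_system.

Section Disintegration_uniqueness.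
Context dZ dY (Z : measurableType dZ) (Y : measurableType dY) (R : realType).
Variables (mu : {measure set Z -> \bar R}) (nu : {measure set Y -> \bar R}).
Variables (q : Z -> Y) (k : R.-pker Y ~> Z).
Hypothesis mq : measurable_fun [set: Z] q.
Hypothesis m1Y : forall y : Y, measurable [set y].
Hypothesis muE : forall B, measurable B -> mu B = (\int[nu]_y k y B)%E.
Hypothesis k_fiber : {ae nu, forall y, k y (q @^-1` [set y]) = 1%E}.

Lemma disintegration_setI A D : measurable A -> measurable D ->
  mu (A `&` q @^-1` D) = (\int[nu]_(y in D) k y A)%E.
Proof.
move=> mA mD.
have mqD : measurable (q @^-1` D) by rewrite -[X in measurable X]setTI; exact: mq.
rewrite muE; last exact: measurableI.
rewrite [RHS]integral_mkcond; apply: ae_eq_integral => //.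
- by apply: measurable_kernel; exact: measurableI.
- apply/(measurable_restrictT _ _).1 => //.
  by apply: measurable_funTS; exact: measurable_kernel.
apply: filterS k_fiber => y ky _; rewrite patchE.
by rewrite (kernel_fiber mq m1Y ky mA mD).
Qed.

End Disintegration_uniqueness.

(** Kernels are compared one event at a time through their integrals over all measurable [D], and
    the two events may live on different spaces. *)
Lemma ae_eq_disintegrations dY dZ dZ' (Y : measurableType dY) (Z : measurableType dZ)
    (Z' : measurableType dZ') (R : realType) (nu : {measure set Y -> \bar R})
    (k : R.-pker Y ~> Z) (k' : R.-pker Y ~> Z') A A' :
  nu [set: Y] = 1%E -> measurable A -> measurable A' ->
  (forall D, measurable D -> (\int[nu]_(y in D) k y A = \int[nu]_(y in D) k' y A')%E) ->
  {ae nu, forall y, k y A = k' y A'}.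
Proof.
move=> nu1 mA mA' h.
have : ae_eq nu [set: Y] (fun y => k y A) (fun y => k' y A').
  apply: integral_ae_eq => //.
  - apply/integrableP; split; first exact: measurable_kernel.
    apply: (@le_lt_trans _ _ (\int[nu]_y (1 : \bar R))%E); last first.
      by rewrite integral_cst//= nu1 mule1 ltry.
    apply: ge0_le_integral => //.
      by apply: measurableT_comp => //; exact: measurable_kernel.
    move=> y _; rewrite gee0_abs// -(@prob_kernel _ _ _ _ _ k y).
    by apply: le_measure; rewrite ?inE.
  - exact: measurable_kernel.
  - by move=> D _ mD; exact: h.
by apply: filterS => y /(_ I).
Qed.

(** * Metric entropy *)

Section Metric_entropy.
Context d (Z : measurableType d) (R : realType) (mu : {measure set Z -> \bar R}).
Hypothesis mu1 : mu [set: Z] = 1%E.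
Variable T : Z -> Z.
Hypothesis mT : measurable_fun [set: Z] T.

Lemma partition_metric_entropyE (I : finType) (f : Z -> I) (P : I -> set Z) :
  (forall i, P i = f @^-1` [set i]) ->
  partition_metric_entropy mu T P = growth_rate (fun n => ent mu (itinerary T f n)).
Proof.
move=> PE; congr limn_esup; apply/funext => n.
by rewrite (partition_entropy_itinerary _ _ _ PE).
Qed.

Lemma metric_entropy_ge (I : finType) (f : Z -> I) : fin_measurable f ->
  (growth_rate (fun n => ent mu (itinerary T f n)) <= metric_entropy mu T)%E.
Proof.
(* [metric_entropy] ranges over partitions indexed by ordinals, hence the renumbering. *)
move=> mf; pose g z := enum_rank (f z).
have mg : fin_measurable g by exact: fin_measurable_comp.
apply: ereal_sup_ubound; exists #|I|, (fun i => g @^-1` [set i]); split.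
  split => //.
  - by move=> i j _ _ [z [/= <- <-]].
  - by apply/seteqP; split => // z _; exists (g z).
rewrite (@partition_metric_entropyE _ g)//; congr growth_rate; apply/funext => n.
apply: (ent_determined mu1); try exact: fin_measurable_itinerary.
move=> z z'; rewrite !itinerary_eqP; split=> h i /h; first exact: enum_rank_inj.
by rewrite /g => ->.
Qed.

Lemma metric_entropy_le (M : \bar R) :
  (forall k (f : Z -> 'I_k), fin_measurable f ->
    (growth_rate (fun n => ent mu (itinerary T f n)) <= M)%E) ->
  (metric_entropy mu T <= M)%E.
Proof.
move=> h; apply: ge_ereal_sup => _ [k [P [[mP tP cP] ->]]].
have /choice[f hf] : forall z, exists i, P i z.
  by move=> z; have : [set: Z] z by []; rewrite -cP => -[i _ Pz]; exists i.
have PE i : P i = f @^-1` [set i].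
  apply/seteqP; split => [z Pz|z /= <-//].
  by apply: (tP (f z) i) => //; exists z.
rewrite (partition_metric_entropyE PE); apply: h => i; rewrite -PE; exact: mP.
Qed.

End Metric_entropy.

Lemma itinerary_comp dZ dZ' (Z : measurableType dZ) (Z' : measurableType dZ')
    (T : Z -> Z) (T' : Z' -> Z') (r : Z -> Z') (I : Type) (f : Z' -> I) n z :
  (forall z, r (T z) = T' (r z)) ->
  itinerary T' f n (r z) = itinerary T (f \o r) n z.
Proof.
move=> rT; apply/ffunP => i; rewrite !ffunE/=; congr f.
by elim: (i : nat) => //= j ->; rewrite rT.
Qed.

Definition pushforward_measure d d' (T : measurableType d) (U : measurableType d')
    (R : realType) (m : {measure set T -> \bar R}) (f : T -> U)
    (mf : measurable_fun setT f) : {measure set U -> \bar R} :=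
  measure_function_pushforward__canonical__measure_function_Measure m mf.

Section Pushforward_probability.
Context d d' (T : measurableType d) (U : measurableType d') (R : realType).
Variables (m : {measure set T -> \bar R}) (f : T -> U).
Hypotheses (mf : measurable_fun setT f) (m1 : m setT = 1%E).

(* mf and m1 are kept as arguments for the instances to be inferable. *)
Definition pushforward_law : set U -> \bar R :=
  let _ := (mf, m1) in pushforward_measure m mf.

HB.instance Definition _ := isMeasure.Build _ U R pushforward_law
  (measure0 (pushforward_measure m mf))
  (fun A => measure_ge0 (pushforward_measure m mf) A)
  (@measure_semi_sigma_additive _ _ _ (pushforward_measure m mf)).

Let pushforward_law_setT : pushforward_law setT = 1%E.
Proof. exact: m1. Qed.

HB.instance Definition _ :=
  Measure_isProbability.Build _ U R pushforward_law pushforward_law_setT.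

Definition pushforward_probability : probability U R := pushforward_law.

End Pushforward_probability.

(** * Integrability of the potential *)

Section Potential.
Variables (R : realType) (S : markov_shift) (X : pmetricType R).
Notation Sigma := (shift_space R S).
Variables (phi : Sigma * X -> R).
Variable eta : {measure set (borel Sigma * borel X) -> \bar R}.
Hypothesis eta1 : eta setT = 1%E.
Hypothesis compact_X : compact [set: X].
Hypothesis holder_phi : holder_continuous (@prod_dist R Sigma X)
                  (fun s t : R => `|s - t|) phi.

Lemma shift_mdist_le1 (x y : Sigma) : mdist x y <= 1.
Proof. by have := @agree_mdist_le _ _ _ _ _ _ (@shift_mdistE R S) 0 x y; rewrite expr0; apply. Qed.

Lemma holder_bounded : exists M, forall z, `|phi z| <= M.
Proof.
have [a a0 [C hC]] := holder_phi.
have [M hM] := compact_mdist_bounded compact_X.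
pose D := Num.max 1 M.
exists (`|phi point| + `|C| * D `^ a) => z.
rewrite -lerBlDl; apply: le_trans (lerB_dist _ _) _.
apply: le_trans (hC _ _) _.
apply: (@le_trans _ _ (`|C| * prod_dist z point `^ a)).
  by rewrite ler_wpM2r ?powR_ge0// ler_norm.
have d0 : 0 <= prod_dist z point by rewrite /prod_dist le_max mdist_ge0.
rewrite ler_wpM2l// ge0_ler_powR ?(ltW a0) ?nnegrE//.
  by rewrite /D le_max ler01.
by rewrite /prod_dist /D ge_max !le_max shift_mdist_le1 hM orbT.
Qed.

Lemma holder_measurable : measurable_fun setT (phi : borel Sigma * borel X -> R).
Proof.
have [a a0 [C hC]] := holder_phi.
move=> mD; apply: (measurability _ (RGenOInfty.measurableE R)) => //.
move=> _ [_ [r ->] <-]; rewrite setTI.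
apply: (open_prod_measurable (@shift_mdistE R S) (@window_agree R S) (@agree_window R S)).
move=> x t; rewrite /= in_itv/= andbT => rx.
have e0 : 0 < phi (x, t) - r by rewrite subr_gt0.
have [s s0 hs] := powR_small C a0 e0.
have [n hn] := agree_small (@shift_mdistE R S) s0.
exists n, (ball t s)°; split; [exact: open_interior|exact: nbhsx_ballx|].
move=> y u xy /interior_subset; rewrite ballEmdist/= => tu.
rewrite in_itv/= andbT.
have : `|phi (x, t) - phi (y, u)| < phi (x, t) - r.
  apply: le_lt_trans (hC _ _) _; apply: hs; first by rewrite /prod_dist le_max mdist_ge0.
  by rewrite /prod_dist gt_max/= hn.
by move=> /(le_lt_trans (ler_norm _)); lra.
Qed.

(** Finiteness allows the integral to be cancelled in the extended reals, so that comparing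
    pressures amounts to comparing entropies. *)
Lemma holder_integral_fin_num : (\int[eta]_z (phi z)%:E)%E \is a fin_num.
Proof.
apply: integrable_fin_num => //; apply: (bounded_measurable_integrable eta1).
by split; [exact: holder_measurable|exact: holder_bounded].
Qed.

End Potential.

(** A difference involving an infinite term is infinite, even [+oo - +oo]; so a zero difference
    forces both terms to be finite. *)
Lemma eq_of_sube_eq0 (R : realDomainType) (x y : \bar R) :
  (x - y = 0)%E -> x = y.
Proof.
case: x => [x| |]; case: y => [y| |] //=.
by move=> /eqP; rewrite -EFinB eqe subr_eq0 => /eqP ->.
Qed.

(** * Comparison of the block entropies and the equality case *)

Section Main.
Variables (R : realType) (S : markov_shift) (X : pmetricType R) (alpha : R).
Variable F : shift_space R S -> X -> X.
Variable eta : probability (borel (shift_space R S) * borel X)%type R.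
Variable eta_u : R.-pker (borel (past_space R S) * borel X)
             ~> (borel (shift_space R S) * borel X)%type.
Variable eta_cu : R.-pker borel (past_space R S)
              ~> (borel (shift_space R S) * borel X)%type.
Variable eta_base : R.-pker borel (past_space R S) ~> borel (shift_space R S).
Hypothesis compact_X : compact [set: X].
Hypothesis alpha_gt0 : 0 < alpha.
Hypothesis holder_fiber : forall w, holder (@mdist R X) (@mdist R X) alpha (F w).
Hypothesis holder_F : holder_continuous (@mdist R (shift_space R S)) (@sup_dist R X X) F.
Hypothesis past_F : forall w w' : shift_space R S,
  (forall i : int, i <= 0 -> letter w i = letter w' i) -> F w = F w'.
Hypothesis invariant_eta : invariant_measure eta (skew_product F).
Hypothesis disint_u : disintegration eta (@past_prod R S X) eta_u.
Hypothesis disint_cu : disintegration eta (@past_fst R S X) eta_cu.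
Hypothesis disint_base : disintegration (base_measure eta)
     (@past R S : borel (shift_space R S) -> borel (past_space R S)) eta_base.

Notation Sigma := (shift_space R S).
Notation Past := (past_space R S).
Notation shift := (@left_shift R S : borel Sigma -> borel Sigma).
Notation C := (@letter0_fst R S X).

Let T := skew_product F.
Let mT : measurable_fun setT T :=
  skew_product_measurable compact_X alpha_gt0 holder_fiber holder_F.
Let eta1 : eta setT = 1%E. Proof. exact: probability_setT. Qed.
Let mC : fin_measurable C. Proof. exact: letter0_fst_measurable. Qed.

Let mqu := @past_prod_measurable R S X.
Let mqc := @past_fst_measurable R S X.
Let nu_u := pushforward_measure eta mqu.
Let nu_c := pushforward_measure eta mqc.
Let base := pushforward_measure eta (@measurable_fst _ _ (borel Sigma) (borel X)).
Let nu_u1 : nu_u setT = 1%E. Proof. exact: probability_setT. Qed.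
Let nu_c1 : nu_c setT = 1%E. Proof. exact: probability_setT. Qed.
Let base1 : base setT = 1%E. Proof. exact: probability_setT. Qed.

Let muE_u : forall B, measurable B -> eta B = (\int[nu_u]_y eta_u y B)%E := disint_u.1.
Let fib_u : {ae nu_u, forall y, eta_u y (@past_prod R S X @^-1` [set y]) = 1%E} := disint_u.2.
Let muE_c : forall B, measurable B -> eta B = (\int[nu_c]_y eta_cu y B)%E := disint_cu.1.
Let fib_c : {ae nu_c, forall y, eta_cu y (@past_fst R S X @^-1` [set y]) = 1%E} := disint_cu.2.
Let m1u : forall y : borel Past * borel X, measurable [set y] := @past_prod_set1 R S X.
Let m1c : forall y : borel Past, measurable [set y] := @borel_set1 R Past.

Let word n := itinerary T C n.
Let mword n : fin_measurable (@word n). Proof. exact: fin_measurable_itinerary. Qed.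
Let a := block_entropy T C nu_u eta_u.
Let b := block_entropy T C nu_c eta_cu.
Let c n := ent eta (@word n).

Let entropy_outE : entropy_out F eta eta_u = growth_rate a.
Proof.
congr limn_esup; apply/funext => n.
have bm : bounded_measurable (fun y => ent (eta_u y) (word n)).
  exact: bounded_measurable_ent.
rewrite -(expectationZ nu_u1 _ bm) /Rintegral fineK.
  apply: eq_integral => y _; congr (_ * _)%:E.
  by apply: partition_entropy_itinerary => s; apply/seteqP; split => [z []|z].
apply: integrable_fin_num => //; apply: (bounded_measurable_integrable nu_u1).
by apply: bounded_measurableM => //; exact: bounded_measurable_cst.
Qed.

Let L j z := past_block j (@past_fst R S X z).
Let mL j : fin_measurable (@L j).
Proof. exact: (fin_measurable_fiber mqc (@past_block_measurable R S j)). Qed.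

Let letter_iter_skew n z i : @letter R S (iter n T z).1 i = @letter R S z.1 (i + n%:Z).
Proof. by rewrite skew_product_iter_fst letter_iter. Qed.

Let LT j z : L j (iter j T z) = itinerary T C j z.
Proof.
apply/ffunP => i; rewrite !ffunE.
have -> : C (iter i T z) = @letter R S z.1 (0 + (i : nat)%:Z) by exact: letter_iter_skew.
have -> : past_letter (past_fst (iter j T z)) (j - i).-1 =
    @letter R S (iter j T z).1 (Negz (j - i).-1) by [].
by rewrite letter_iter_skew; congr letter; have := ltn_ord i; lia.
Qed.

Let L_refine i j : (i <= j)%N -> forall z z', L j z = L j z' -> L i z = L i z'.
Proof. by move=> ij z z'; exact: past_block_refine. Qed.

Let W j (z : borel Sigma * borel X) := @window R S j z.1.

Let WT j z : W j (iter j T z) = itinerary T C (j + j) z.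
Proof.
apply/ffunP => i; rewrite !ffunE.
have -> : C (iter i T z) = @letter R S z.1 (0 + (i : nat)%:Z) by exact: letter_iter_skew.
by rewrite letter_iter_skew; congr letter; lia.
Qed.

Let itinerary_fst (I : Type) (f : borel Sigma -> I) n z :
  itinerary shift f n z.1 = itinerary T (f \o fst) n z.
Proof. exact: (itinerary_comp (r := fst)). Qed.

Let ent_base (I : finType) (f : borel Sigma -> I) n :
  ent base (itinerary shift f n) = ent eta (itinerary T (f \o fst) n).
Proof.
have -> : itinerary T (f \o fst) n = (fun z => itinerary shift f n z.1).
  by apply/funext => z; rewrite itinerary_fst.
by [].
Qed.

Let base_entropy_le : (metric_entropy (base_measure eta) shift <= metric_entropy eta T)%E.
Proof.
apply: (metric_entropy_le (mu := base)) => k f mf.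
under [X in growth_rate X]funext do rewrite ent_base.
by apply: metric_entropy_ge => //; exact: (fin_measurable_fiber measurable_fst mf).
Qed.

Let rate_le_base : (growth_rate c <= metric_entropy (base_measure eta) shift)%E.
Proof.
have := @metric_entropy_ge _ _ _ base base1 shift (@left_shift_measurable R S) _ _ (@letter0_measurable R S).
by under [X in growth_rate X]funext do rewrite ent_base.
Qed.

(** Windows generate the Borel sets of the base, so every finite partition is approximated by them
    and its growth rate is at most that of the letters. *)
Let base_entropy_le_rate :
  (metric_entropy (base_measure eta) shift <= (entropy_rate eta T C)%:E)%E.
Proof.
apply: (metric_entropy_le (mu := base)) => k f mf.
under [X in growth_rate X]funext do rewrite ent_base.
have mW := agree_window_measurable (@shift_mdistE R S) (@agree_window R S).
apply: (growth_rate_itinerary_le eta1 mT invariant_eta mC mL LT L_refine (W := W)) => //.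
- exact: (fin_measurable_fiber measurable_fst mf).
- by move=> j; exact: (fin_measurable_fiber measurable_fst (@mW j)).
- move=> e e0; have := @cent_approximation _ _ _ base base1 _ (@window R S) mW
    (@window_refine R S) _ f mf.
  move=> /(_ _ e e0); apply => i.
  exact: (borel_approximable (@shift_mdistE R S) (@window_agree R S) (@agree_window R S)
    base1 (@window_refine R S)).
Qed.

Let a_le_c n : a n <= c n.
Proof. exact: (block_entropy_le eta1 mT mC nu_u1 mqu m1u muE_u fib_u). Qed.

Let b_le_c n : b n <= c n.
Proof. exact: (block_entropy_le eta1 mT mC nu_c1 mqc m1c muE_c fib_c). Qed.

Let a_ge0 n : 0 <= a n. Proof. exact: block_entropy_ge0. Qed.

Let a_sub n m : a (n + m)%N <= a n + a m.
Proof.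
apply: (block_entropy_subadditive eta1 mT invariant_eta mC nu_u1 mqu m1u muE_u fib_u
  (Phi := fun n => @block_map R S X F n)).
- by move=> i w; exact: (block_map_measurable compact_X alpha_gt0 holder_fiber holder_F).
- by move=> i z; exact: block_mapE.
Qed.

Let b_rate n : (0 < n)%N -> ((n%:R^-1 * b n)%:E <= growth_rate c)%E.
Proof.
exact: (block_entropy_growth_rate_ge eta1 mT invariant_eta mC nu_c1 mqc m1c muE_c fib_c
  mL LT (@past_block_measurable R S)).
Qed.

Let b_ge_rate n : n%:R * entropy_rate eta T C <= b n.
Proof.
apply: (entropy_rate_le_block_entropy eta1 mT invariant_eta mC nu_c1 mqc m1c muE_c fib_c mL LT).
move=> J G mG e e0.
have := @cent_approximation _ _ _ nu_c nu_c1 _ (@past_block R S)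
  (@past_block_measurable R S) (@past_block_refine R S) _ G mG.
move=> /(_ _ e e0); apply => i.
exact: (borel_approximable (@past_mdistE R S) (@past_block_agree R S) (@agree_past_block R S)
  nu_c1 (@past_block_refine R S)).
Qed.

Let itinerary_fstE n z : itinerary shift (@letter0 R S) n z.1 = word n z.
Proof. exact: itinerary_fst. Qed.

(** A cylinder is a condition on the past, constant on the fibers of [past_fst], together with one
    on the next [n] letters; only the latter is random under [eta_cu p]. *)
Let window_pastE n (v : {ffun 'I_(n + n) -> symbol S}) z :
  @window R S n z.1 = v <->
  past_block n (past_fst z) = [ffun i => v (lshift n i)] /\
  word n z = [ffun i => v (rshift n i)].
Proof.
have pastE (i : 'I_n) : past_block n (past_fst z) i = @window R S n z.1 (lshift n i).
  rewrite !ffunE; have -> : past_letter (past_fst z) (n - i).-1 =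
    @letter R S z.1 (Negz (n - i).-1) by [].
  by congr letter; have := ltn_ord i; rewrite /=; lia.
have futureE (i : 'I_n) : word n z i = @window R S n z.1 (rshift n i).
  rewrite !ffunE.
  have -> : C (iter i T z) = @letter R S z.1 (0 + (i : nat)%:Z) by exact: letter_iter_skew.
  by congr letter; rewrite /=; lia.
split=> [vE|[/ffunP hp /ffunP hf]].
  by split; apply/ffunP => i; rewrite ?pastE ?futureE vE ffunE.
apply/ffunP => i; rewrite -(splitK i); case: (fintype.split i) => j /=.
  by have := hp j; rewrite pastE => ->; rewrite ffunE.
by have := hf j; rewrite futureE => ->; rewrite ffunE.
Qed.

Let c0 : c 0 = 0.
Proof.
apply: (ent_constant eta1 (j := word 0 point)) => //.
rewrite (_ : _ @^-1` _ = setT)//; apply/seteqP; split => // z _ /=.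
by apply/ffunP => -[].
Qed.

(** On a cylinder the marginal of [eta_cu p] is [eta_base p] for almost every [p]: integrated over
    [D], both give the mass of the part of the cylinder whose past lies in [D]. *)
Let future_kernel_eq n (v : {ffun 'I_(n + n) -> symbol S}) :
  {ae nu_c, forall p, eta_cu p (fst @^-1` (@window R S n @^-1` [set v])) =
                      eta_base p (@window R S n @^-1` [set v])}.
Proof.
have mA := agree_window_measurable (@shift_mdistE R S) (@agree_window R S) (n := n) v.
have mA' : measurable ((fst : borel Sigma * borel X -> _) @^-1` (@window R S n @^-1` [set v])).
  by rewrite -[X in measurable X]setTI; exact: measurable_fst.
apply: ae_eq_disintegrations => // D mD.
rewrite -(disintegration_setI mqc m1c muE_c fib_c mA' mD).
by rewrite -(@disintegration_setI _ _ _ _ R base nu_c _ eta_base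
  (@past_measurable R S) m1c disint_base.1 disint_base.2 _ _ mA mD).
Qed.

(** The entropy bound makes every word independent of every basic open set of [X] under almost every
    [eta_cu p]; a pi-system argument then yields a product measure. *)
Lemma future_independent_of_block_entropy_le :
  (forall n, b n <= a n) -> future_independent eta eta_cu eta_base.
Proof.
move=> ba.
have [E [ET EI Egen]] := second_countable_pi_system (compact_second_countable compact_X).
have mE m : measurable (E m : set (borel X)).
  by rewrite Egen; apply: sub_sigma_algebra; exists m.
pose e m (y : borel Past * borel X) := `[<E m y.2>].
have me m : fin_measurable (e m).
  apply: fin_measurable_bool; rewrite -[X in measurable X]setTI.
  exact: (measurable_snd measurableT _ (mE m)).
(* The families in [n] and [m] are countable, so one null set serves for all. *)
have H1 : {ae nu_c, forall p n m i j,
    law (eta_cu p) (fun z => (word n z, e m (@past_prod R S X z))) (i, j) =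
    law (eta_cu p) (@word n) i * law (eta_cu p) (fun z => e m (@past_prod R S X z)) j}.
  apply: ae_foralln => n; apply: ae_foralln => m.
  apply: (independent_of_expectation_ent_le eta1 nu_c1 mqc m1c muE_c fib_c
    nu_u1 mqu m1u muE_u fib_u (@mword n) (me m) measurable_fst) => //.
  exact: ba.
have H2 : {ae nu_c, forall p n v, eta_cu p (fst @^-1` (@window R S n @^-1` [set v])) =
                      eta_base p (@window R S n @^-1` [set v])}.
  by apply: ae_foralln => n; apply: filter_forall => v; exact: future_kernel_eq.
apply: filterS3 H1 H2 fib_c => p h1 h2 ky.
have k1 : eta_cu p setT = 1%E by exact: prob_kernel.
(* The factor on [X] can only be the marginal of [eta_cu p]. *)
pose sigma := pushforward_probability (@measurable_snd _ _ (borel Sigma) (borel X)) k1.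
exists sigma.
apply: (product_measure_unique_generated _ (@window_cylinder_generated R S) Egen) => //.
- exact: prob_kernel.
- by right; left.
- exact: window_cylinder_setI.
move=> A _ [->|[->|[n [v ->]]]] [m _ <-].
- by rewrite set0X !measure0 mul0e.
- by rewrite setTX prob_kernel mul1e.
pose D := @past_block R S n @^-1` [set [ffun i => v (lshift n i)]].
pose w := [ffun i => v (rshift n i)].
have mD : measurable D by exact: past_block_measurable.
have mEm : measurable ((snd : borel Sigma * borel X -> _) @^-1` E m).
  by rewrite -[X in measurable X]setTI; exact: (measurable_snd measurableT _ (mE m)).
have mw : measurable (word n @^-1` [set w]) by exact: mword.
have sE : sigma (E m) = eta_cu p (snd @^-1` E m) by [].
rewrite -h2 sE.
have -> : (@window R S n @^-1` [set v]) `*` E m =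
    (word n @^-1` [set w] `&` snd @^-1` E m) `&` @past_fst R S X @^-1` D.
  apply/seteqP; split => [z [/= /window_pastE[h h'] Ez]//|z [[/= h Ez] h']].
  by split => //; apply/window_pastE.
have -> : fst @^-1` (@window R S n @^-1` [set v]) =
    word n @^-1` [set w] `&` @past_fst R S X @^-1` D.
  apply/seteqP; split => [z /= /window_pastE[]//|z [/= h h']].
  by apply/window_pastE.
rewrite (kernel_fiber mqc m1c ky _ mD); last exact: measurableI.
rewrite (kernel_fiber mqc m1c ky mw mD).
(* If [p] violates the past condition [D], both sides vanish. *)
case: ifPn => _; last by rewrite mul0e.
have := h1 n m w true; rewrite /law.
have -> : (fun z => e m (@past_prod R S X z)) @^-1` [set true] = snd @^-1` E m.
  by apply/seteqP; split => z /=; [move/asboolP|move=> ?; exact/asboolP].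
have -> : (fun z => (word n z, e m (@past_prod R S X z))) @^-1` [set (w, true)] =
    word n @^-1` [set w] `&` snd @^-1` E m.
  apply/seteqP; split => z /=; first by move=> [-> /asboolP].
  by move=> [-> h]; congr pair; exact/asboolP.
move=> h; rewrite -[LHS]fineK; last by apply: (measure1_fin k1); exact: measurableI.
by rewrite h EFinM !fineK//; exact: (measure1_fin k1).
Qed.

(** On the fiber over [p] a function of the past and the point depends on the point alone; under a
    product measure it is independent of the letters. *)
Lemma block_entropy_le_of_future_independent :
  future_independent eta eta_cu eta_base -> forall n, b n <= a n.
Proof.
move=> fi' n.
have fi : {ae nu_c, forall p, exists sigma : probability (borel X) R,
    forall B, measurable B -> eta_cu p B = (eta_base p \x sigma)%E B} := fi'.
apply: (expectation_ent_le_of_independent eta1 nu_c1 muE_c nu_u1 mqu m1u muE_u fib_u (@mword n)).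
move=> J G mG; apply: filterS2 fi fib_c => p [sigma sE] ky.
have k1 : eta_cu p setT = 1%E by exact: prob_kernel.
have mGq := fin_measurable_fiber mqu mG.
apply: (ent_independent k1 (@mword n) mGq) => w j.
pose Ej := [set t : borel X | G (p, t) = j].
have mEj : measurable Ej.
  have := @measurable_pair1 _ _ (borel Past) (borel X) p.
  by move=> /(_ measurableT _ (mG j)); rewrite setTI.
pose Aw := itinerary shift (@letter0 R S) n @^-1` [set w].
have mAw : measurable Aw.
  exact: (fin_measurable_itinerary (@left_shift_measurable R S) (@letter0_measurable R S)).
have mfib : measurable (@past_fst R S X @^-1` [set p]).
  by rewrite -[X in measurable X]setTI; exact: (mqc measurableT (m1c p)).
(* [eta_cu p] charges only the fiber over [p], so events may be altered off it. *)
have fiberE A A' : measurable A -> measurable A' ->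
    A `&` @past_fst R S X @^-1` [set p] = A' `&` @past_fst R S X @^-1` [set p] ->
    eta_cu p A = eta_cu p A'.
  move=> mA mA' AA'; have := kernel_fiber mqc m1c ky mA (m1c p).
  by rewrite AA' (kernel_fiber mqc m1c ky mA' (m1c p)) mem_set.
have wE : eta_cu p (word n @^-1` [set w]) = eta_base p Aw.
  have -> : word n @^-1` [set w] = Aw `*` setT.
    apply/seteqP; split => [z /= zw|z [/= zw _]]; last by rewrite -itinerary_fstE.
    by split => //; rewrite /Aw /= itinerary_fstE.
  rewrite sE; last exact: measurableX.
  by rewrite product_measure1E// [X in (_ * X)%E](_ : _ = 1%E) ?mule1//; exact: probability_setT.
have GE : eta_cu p ((fun z => G (@past_prod R S X z)) @^-1` [set j]) = sigma Ej.
  rewrite (fiberE _ (setT `*` Ej)) ?sE ?product_measure1E ?prob_kernel ?mul1e//; last first.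
  - apply/seteqP; split => [z [/= Gz zp]|z [[_ /= Gz] /= zp]]; split => //=.
      by split => //; rewrite /Ej /= -zp.
    by rewrite /past_prod -Gz -zp.
  - exact: measurableX.
  - exact: measurableX.
rewrite /law -fineM; last 2 first.
  exact: (measure1_fin k1 (mword w)).
  exact: (measure1_fin k1 (mGq j)).
congr fine; rewrite wE GE -product_measure1E// -sE; last exact: measurableX.
apply: fiberE.
- exact: (fin_measurable_pair (@mword n) mGq).
- exact: measurableX.
apply/seteqP; split => [z [/= /pair_equal_spec[wz Gz] zp]|z [[/= wz Gz] zp]]; split => //.
  by split; [rewrite /Aw /= itinerary_fstE|rewrite /Ej /= -zp].
by apply/pair_equal_spec; split; [rewrite -itinerary_fstE|rewrite -Gz -zp].
Qed.

Lemma entropy_out_le : (entropy_out F eta eta_u <= metric_entropy eta T)%E.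
Proof.
rewrite entropy_outE; apply: le_trans (metric_entropy_ge eta1 mT mC).
exact: le_growth_rate.
Qed.

Lemma entropy_out_eq : entropy_out F eta eta_u = metric_entropy eta T <->
  future_independent eta eta_cu eta_base /\ fiber_entropy F eta = 0%E.
Proof.
rewrite entropy_outE; split=> [h|[fi /eq_of_sube_eq0 h]].
  have hB : metric_entropy (base_measure eta) shift = metric_entropy eta T.
    apply/le_anti; rewrite base_entropy_le -h/=.
    by apply: le_trans rate_le_base; exact: le_growth_rate.
  split.
    (* Length 0 is treated apart, as the rates carry no information there; [c 0 = 0] settles it. *)
    apply: future_independent_of_block_entropy_le => -[|n].
      by apply: le_trans (b_le_c 0) _; rewrite c0.
    (* With [n + 1] for [n]: [b n / n] is at most the rate of [c], then h(T), then h(F), which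
       equals the rate of [a] and so is at most [a n / n]. *)
    have := growth_rate_subadditive a_ge0 a_sub (ltn0Sn n).
    rewrite h => /(le_trans base_entropy_le)/(le_trans rate_le_base).
    move=> /(le_trans (b_rate (ltn0Sn n))).
    by rewrite lee_fin ler_pM2l// invr_gt0 ltr0n.
  (* Equal extended reals have difference 0 only if they are finite; here the common value lies
     between 0 and [a 1]. *)
  rewrite /fiber_entropy hB subee// -h fin_numElt.
  apply/andP; split.
    apply: (@lt_le_trans _ _ 0%E); first exact: ltNyr.
    apply: (@growth_rate_ge _ _ 0) => N; exists N.+1 => //=.
    by rewrite mulr0.
  by apply: le_lt_trans (growth_rate_subadditive a_ge0 a_sub (ltn0Sn 0)) _; exact: ltry.
(* Now h(F) = h(T) is at most the entropy rate, below which [b n / n], and hence [a n / n], does not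
   fall for positive [n]. *)
apply/le_anti; rewrite -entropy_outE entropy_out_le/= entropy_outE h.
apply: le_trans base_entropy_le_rate _.
apply: growth_rate_ge => N; exists N.+1; rewrite ?leqnSn//=.
apply: le_trans (b_ge_rate _) _; exact: block_entropy_le_of_future_independent.
Qed.

End Main.

Theorem mainTheorem4 (R : realType) (S : markov_shift) (X : pmetricType R)
  (alpha : R) (F : shift_space R S -> X -> X) (phi : shift_space R S * X -> R)
  (eta : probability (borel (shift_space R S) * borel X)%type R)
  (eta_u : R.-pker (borel (past_space R S) * borel X)
             ~> (borel (shift_space R S) * borel X)%type)
  (eta_cu : R.-pker borel (past_space R S)
              ~> (borel (shift_space R S) * borel X)%type)
  (eta_base : R.-pker borel (past_space R S) ~> borel (shift_space R S))
  (transitive_shift : topologically_transitive (@left_shift R S))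
  (compact_X : compact [set: X])
  (alpha_gt0 : 0 < alpha)
  (holder_fiber : forall w, holder (@mdist R X) (@mdist R X) alpha (F w))
  (homeo_fiber : forall w, homeomorphism (F w))
  (holder_F : holder_continuous (@mdist R (shift_space R S))
                (@sup_dist R X X) F)
  (holder_phi : holder_continuous (@prod_dist R (shift_space R S) X)
                  (fun s t : R => `|s - t|) phi)
  (past_F : forall w w' : shift_space R S,
     (forall i : int, i <= 0 -> letter w i = letter w' i) -> F w = F w')
  (invariant_eta : invariant_measure eta (skew_product F))
  (disint_u : disintegration eta (@past_prod R S X) eta_u)
  (disint_cu : disintegration eta (@past_fst R S X) eta_cu)
  (disint_base : disintegration (base_measure eta)
     (@past R S : borel (shift_space R S) -> borel (past_space R S)) eta_base) :
  (pressure_out F eta eta_u phi <= metric_pressure F eta phi)%E /\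
  (pressure_out F eta eta_u phi = metric_pressure F eta phi <->
     future_independent eta eta_cu eta_base /\ fiber_entropy F eta = 0%E).
Proof.
have phi_fin := holder_integral_fin_num (probability_setT eta) compact_X holder_phi.
have entropy_eq := entropy_out_eq compact_X alpha_gt0 holder_fiber holder_F past_F
  invariant_eta disint_u disint_cu disint_base.
split.
  rewrite /pressure_out /metric_pressure leeD2r//.
  exact: (entropy_out_le compact_X alpha_gt0 holder_fiber holder_F disint_u).
rewrite -entropy_eq /pressure_out /metric_pressure; split => [h|-> //].
by rewrite -[LHS](addeK _ phi_fin) h addeK.
Qed.
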